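(* Let $n\ge 2$ be an integer, and consider a nonzero mirror symmetric function $f\in L^2(\mathbb{R}_+^n)$. Then the Wigner integral $I_n^S(f)$ satisfies $\varphi[I_n^S(f)^4]>2\,\varphi[I_n^S(f)^2]^2$. In particular, the distribution of the Wigner integral $I_n^S(f)$ cannot be semicircular.
   Context: $\mathbb{R}_+=[0,\infty)$; $L^2$ spaces are complex-valued, with Lebesgue measure. A $W^*$-probability space $(\mathscr{A},\varphi)$ is a von Neumann algebra $\mathscr{A}$ with a weakly continuous, positive, faithful, unital tracial linear functional $\varphi$ (the expectation). The law (distribution) of a self-adjoint $X\in\mathscr{A}$ is the unique Borel probability measure $\mu_X$ on $\mathbb{R}$ with $\int t^m\,\mu_X(dt)=\varphi(X^m)$ for all $m\ge 0$. Unital subalgebras $\mathscr{A}_1,\dots,\mathscr{A}_r$ are freely independent if $\varphi(X_1\cdots X_m)=0$ whenever $\varphi(X_j)=0$ for all $j$, each $X_j$ belongs to one of the $\mathscr{A}_i$, and consecutive $X_j,X_{j+1}$ do not come from the same $\mathscr{A}_i$; elements are freely independent if the unital algebras they generate are. The (centred) semicircular law $S(0,t)$, $t>0$, is $\frac{1}{2\pi t}\sqrt{4t-x^2}\,dx$ on $|x|\le 2\sqrt t$; ''semicircular'' means being of this form for some $t>0$. A free Brownian motion $S=(S_t)_{t\ge0}$ is a family of self-adjoint elements of a $W^*$-probability space $(\mathscr{A},\varphi)$ with $S_0=0$, $S_{t_2}-S_{t_1}$ of law $S(0,t_2-t_1)$ for $t_1<t_2$, and freely independent increments over successive intervals. Fix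 one. Wigner integral: for $f=\mathbf{1}_{[s_1,t_1]\times\cdots\times[s_n,t_n]}$ with pairwise disjoint intervals $[s_i,t_i]$, $I_n^S(f)=(S_{t_1}-S_{s_1})\cdots(S_{t_n}-S_{s_n})$; extend linearly, and then by the isometry $\varphi[I_n^S(g)^*I_n^S(f)]=\langle f,g\rangle_{L^2(\mathbb{R}_+^n)}$, to all of $L^2(\mathbb{R}_+^n)$. (Each $I_n^S(f)$ is a bounded operator.) $f\in L^2(\mathbb{R}_+^n)$ is mirror symmetric if $f(t_1,\dots,t_n)=\overline{f(t_n,\dots,t_1)}$ for a.e. $(t_1,\dots,t_n)$; then $I_n^S(f)$ is self-adjoint. *)

(* Defs.v *)
From HB Require Import structures.
From mathcomp Require Import all_boot all_order all_algebra.
From mathcomp Require Import complex.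
From mathcomp Require Import all_classical all_reals all_analysis.
From mathcomp Require Import measurable_realfun.

Set Implicit Arguments.
Unset Strict Implicit.
Unset Printing Implicit Defensive.

Import Order.TTheory GRing.Theory Num.Theory Num.Def.
Import numFieldNormedType.Exports.

Local Open Scope classical_set_scope.
Local Open Scope ring_scope.

(* Lebesgue measure on R^n, with R^n represented by [n.-tuple] and its product
   sigma-algebra: a Dirac mass for n = 0, and the image of
   lebesgue_measure \x lebesgueN n under (x, v) |-> x :: v for n + 1. *)
Section cons_measure.
Context d (T : measurableType d) (R : realType) (n : nat).
Variables (mu : {sigma_finite_measure set T -> \bar R})
          (nu : {sigma_finite_measure set (n.-tuple T) -> \bar R}).

Definition cons_pair (p : T * n.-tuple T) : n.+1.-tuple T :=
  [tuple of p.1 :: p.2].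

Definition uncons_pair (t : n.+1.-tuple T) : T * n.-tuple T :=
  (thead t, [tuple of behead t]).

Lemma cons_pairK : cancel cons_pair uncons_pair.
Proof.
by move=> [x v]; rewrite /uncons_pair /cons_pair /=; congr pair; exact: val_inj.
Qed.

Lemma measurable_cons_pair : measurable_fun setT cons_pair.
Proof. exact: measurable_cons. Qed.

Lemma measurable_uncons_pair : measurable_fun setT uncons_pair.
Proof.
apply/measurable_fun_pairP; split; last exact: measurable_behead.
exact: measurable_tnth.
Qed.

Definition cons_measure : set (n.+1.-tuple T) -> \bar R :=
  pushforward (mu \x nu)%E cons_pair.

Let cons_measure0 : cons_measure set0 = 0%E.
Proof. by rewrite /cons_measure /pushforward preimage_set0 measure0. Qed.

Let cons_measure_ge0 A : (0 <= cons_measure A)%E.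
Proof. by rewrite /cons_measure /pushforward measure_ge0. Qed.

Let cons_measure_sigma_additive : semi_sigma_additive cons_measure.
Proof.
move=> F mF tF mUF; rewrite /cons_measure /pushforward preimage_bigcup.
apply: measure_semi_sigma_additive.
- by move=> k; rewrite -[X in measurable X]setTI; exact: measurable_cons_pair.
- apply/trivIsetP => /= i j _ _ ij; rewrite -preimage_setI.
  by move/trivIsetP : tF => /(_ _ _ _ _ ij) ->//; rewrite preimage_set0.
- rewrite -preimage_bigcup -[X in measurable X]setTI.
  exact: measurable_cons_pair.
Qed.

HB.instance Definition _ := isMeasure.Build _ _ _ cons_measure
  cons_measure0 cons_measure_ge0 cons_measure_sigma_additive.

Let cons_measure_sigma_finite : sigma_finite setT cons_measure.
Proof.
have /sigma_finiteP[F [TF ndF Foo]] := sigma_finiteT mu.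
have /sigma_finiteP[G [TG ndG Goo]] := sigma_finiteT nu.
exists (fun k => uncons_pair @^-1` (F k `*` G k)).
  apply/esym; rewrite -subTset => t _; rewrite -preimage_bigcup /preimage /=.
  have /= : (\bigcup_k F k) (uncons_pair t).1 by rewrite -TF.
  have /= : (\bigcup_k G k) (uncons_pair t).2 by rewrite -TG.
  move=> [j _ Gj] [i _ Fi]; exists (maxn i j) => //; split.
  - by move: Fi; apply/subsetPset/ndF/leq_maxl.
  - by move: Gj; apply/subsetPset/ndG/leq_maxr.
move=> k; have [mFk Fkoo] := Foo k; have [mGk Gkoo] := Goo k; split.
  rewrite -[X in measurable X]setTI; apply: measurable_uncons_pair => //.
  exact: measurableX.
rewrite /cons_measure /pushforward -comp_preimage.
rewrite (_ : _ \o _ = id) ?preimage_id; last first.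
  by apply/funext => p /=; rewrite cons_pairK.
by rewrite product_measure1E// lte_mul_pinfty// ge0_fin_numE.
Qed.

HB.instance Definition _ := Measure_isSigmaFinite.Build _ _ _ cons_measure
  cons_measure_sigma_finite.

End cons_measure.

Fixpoint lebesgueN (R : realType) (n : nat) :
    {sigma_finite_measure set (n.-tuple (measurableTypeR R)) -> \bar R} :=
  match n with
  | 0 => \d_([tuple] : 0.-tuple (measurableTypeR R))
  | m.+1 => cons_measure (@lebesgue_measure R) (lebesgueN R m)
  end.

Section square_integrable.
Variable R : realType.
Local Notation C := R[i].
Variable n : nat.
Implicit Types f g : n.-tuple (measurableTypeR R) -> C.

Definition orthant : set (n.-tuple (measurableTypeR R)) :=
  [set t | forall i, 0 <= tnth t i :> R].

Definition sqr_modulus (z : C) : R := complex.Re z ^+ 2 + complex.Im z ^+ 2.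

Definition sqr_norm f : \bar R :=
  (\int[lebesgueN R n]_(t in orthant) (sqr_modulus (f t))%:E)%E.

(* Elements of L^2(R_+^n) are handled through representatives; only their
   values on R_+^n matter. *)
Definition square_integrable f : Prop :=
  [/\ measurable_fun orthant (fun t => complex.Re (f t)),
      measurable_fun orthant (fun t => complex.Im (f t)) &
      (sqr_norm f < +oo)%E].

Definition ae_orthant (P : n.-tuple (measurableTypeR R) -> Prop) : Prop :=
  {ae lebesgueN R n, forall t, orthant t -> P t}.

Definition mirror_symmetric f : Prop :=
  ae_orthant (fun t => f t = (f [tuple of rev t])^*).

End square_integrable.
Arguments orthant : clear implicits.

Section semicircular.
Variable R : realType.

Definition semicircular_pdf (t x : R) : R :=
  if `|x| <= 2 * Num.sqrt t then Num.sqrt (4 * t - x ^+ 2) / (2 * pi * t)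
  else 0.

Lemma measurable_semicircular_pdf t :
  measurable_fun setT (semicircular_pdf t : measurableTypeR R -> R).
Proof.
apply: measurable_fun_ifT => //=.
- apply: measurable_fun_ler => //; exact: measurableT_comp.
- apply: measurable_funM => //.
  apply: (measurableT_comp (continuous_measurable_fun (@sqrt_continuous R))).
  apply: measurable_funB => //; exact: measurable_funX.
Qed.

Variable t : R.

Definition semicircular : set (measurableTypeR R) -> \bar R :=
  fun A => (\int[lebesgue_measure]_(x in A) (semicircular_pdf t x)%:E)%E.

Let semicircular_pdf_ge0 x : 0 <= semicircular_pdf t x.
Proof.
rewrite /semicircular_pdf; case: ifP => // xt.
have [t0|t0] := leP 0 t; first by rewrite divr_ge0 ?sqrtr_ge0// !mulr_ge0 ?pi_ge0.
by rewrite ler0_sqrtr ?mul0r// subr_le0 (le_trans _ (sqr_ge0 x))// pmulr_rle0 ?ltW.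
Qed.

Let semicircular0 : semicircular set0 = 0%E.
Proof. by rewrite /semicircular integral_set0. Qed.

Let semicircular_ge0 A : (0 <= semicircular A)%E.
Proof. by apply: integral_ge0 => x _; rewrite lee_fin. Qed.

Let semicircular_sigma_additive : semi_sigma_additive semicircular.
Proof.
move=> /= A mA tA mUA; rewrite /semicircular ge0_integral_bigcup//=.
- by apply: is_cvg_ereal_nneg_natsum_cond => n _ _; exact: semicircular_ge0.
- apply/measurable_EFinP; apply: measurable_funTS.
  exact: measurable_semicircular_pdf.
- by move=> x _; rewrite lee_fin.
Qed.

HB.instance Definition _ := isMeasure.Build _ _ _ semicircular
  semicircular0 semicircular_ge0 semicircular_sigma_additive.

End semicircular.

Section hilbert.
Variable R : realType.
Local Notation C := R[i].

(* The inner product is linear in its first argument; completeness is that of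
   [completeNormedModType]. *)
Record hilbertSpace := HilbertSpace {
  hilbert_sort :> completeNormedModType C;
  hdot : {dot hilbert_sort for (@conjC C)};
  hdot_norm : forall x, hdot x x = `|x| ^+ 2 }.

(* Basic neighbourhoods of the weak operator topology. *)
Definition weakly_close (H : hilbertSpace) (s : seq (H * H)) (e : C)
    (T U : H -> H) : Prop :=
  forall p, p \in s -> `|hdot H (T p.1 - U p.1) p.2| < e.

(* A von Neumann algebra: an algebra [vn_sort] together with a faithful
   *-representation [vn_op] by bounded operators on a Hilbert space whose image
   is closed in the weak operator topology. *)
Record vonNeumannAlgebra := VonNeumannAlgebra {
  vn_sort :> algType C;
  vn_space : hilbertSpace;
  vn_op : vn_sort -> {linear vn_space -> vn_space};
  vn_star : vn_sort -> vn_sort;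
  vn_op_bounded : forall a, continuous (vn_op a);
  vn_op_linear : forall k a b x,
    vn_op (k *: a + b) x = k *: vn_op a x + vn_op b x;
  vn_op1 : forall x, vn_op 1 x = x;
  vn_opM : forall a b x, vn_op (a * b) x = vn_op a (vn_op b x);
  vn_op_inj : forall a b, vn_op a =1 vn_op b -> a = b;
  vn_op_star : forall a x y, hdot vn_space (vn_op a x) y = hdot vn_space x (vn_op (vn_star a) y);
  vn_wot_closed : forall T : {linear vn_space -> vn_space}, continuous T ->
    (forall (s : seq (vn_space * vn_space)) (e : C), 0 < e ->
       exists a, weakly_close s e (vn_op a) T) ->
    exists a, vn_op a =1 T }.

(* Weak continuity of the trace is continuity for the weak operator topology on
   norm-bounded sets, i.e. continuity for the sigma-weak topology. *)
Definition weakly_continuous (A : vonNeumannAlgebra) (phi : A -> C) : Prop :=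
  forall (M : C) (a : A) (e : C), 0 < e ->
  exists (s : seq (vn_space A * vn_space A)) (d : C), 0 < d /\
    forall b, (forall x, `|vn_op b x| <= M * `|x|) ->
      weakly_close s d (vn_op b) (vn_op a) -> `|phi b - phi a| < e.

Record WstarProbSpace := MkWstarProbSpace {
  wps_alg :> vonNeumannAlgebra;
  expect : {scalar wps_alg};
  expect_weak : weakly_continuous expect;
  expect_ge0 : forall a, 0 <= expect (vn_star a * a);
  expect_faithful : forall a, expect (vn_star a * a) = 0 -> a = 0;
  expect1 : expect 1 = 1;
  expect_tracial : forall a b, expect (a * b) = expect (b * a) }.

End hilbert.

Section free_probability.
Variable R : realType.
Local Notation C := R[i].
Variable A : WstarProbSpace R.
Local Notation phi := (expect A).

Definition generated_algebra (a : A) : set A :=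
  smallest (fun B : set A => GRing.subalg_closed [in B]) [set a].

Definition freely_independent (I : Type) (B : I -> set A) : Prop :=
  forall m (i : 'I_m.+1 -> I) (X : 'I_m.+1 -> A),
    (forall j, B (i j) (X j)) -> (forall j, phi (X j) = 0) ->
    (forall j k : 'I_m.+1, k = j.+1 :> nat -> i j <> i k) ->
    phi (\prod_(j < m.+1) X j) = 0.

(* The case m = 0 makes [mu] a probability measure. *)
Definition is_law (X : A) (mu : {measure set (measurableTypeR R) -> \bar R})
    : Prop :=
  forall m : nat,
    mu.-integrable setT (fun x : measurableTypeR R => ((x : R) ^+ m)%:E) /\
    (\int[mu]_x (x : R) ^+ m)%:C%C = phi (X ^+ m).

Definition is_semicircular (X : A) : Prop :=
  exists2 t : R, 0 < t & is_law X (semicircular t).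

(* Only the values of [S] on [0, +oo[ matter. *)
Definition free_brownian_motion (S : R -> A) : Prop :=
  [/\ S 0 = 0,
      forall t, 0 <= t -> vn_star (S t) = S t,
      forall t1 t2, 0 <= t1 -> t1 < t2 ->
        is_law (S t2 - S t1) (semicircular (t2 - t1)) &
      forall (r : nat) (t : nat -> R), 0 <= t 0%N ->
        (forall i, (i < r)%N -> t i < t i.+1) ->
        freely_independent
          (fun i : 'I_r => generated_algebra (S (t i.+1) - S (t i)))].

Section wigner_integral.
Variables (S : R -> A) (n : nat).

(* The pair in position i holds the endpoints s_i, t_i of the i-th interval. *)
Definition off_diagonal_box (b : n.-tuple (R * R)) : Prop :=
  (forall i, 0 <= (tnth b i).1 < (tnth b i).2) /\
  trivIset setT (fun i : 'I_n => `[(tnth b i).1, (tnth b i).2]%classic).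

Definition box_indic (b : n.-tuple (R * R))
    (t : n.-tuple (measurableTypeR R)) : C :=
  [forall i, (tnth b i).1 <= tnth t i <= (tnth b i).2]%:R.

Definition box_integral (b : n.-tuple (R * R)) : A :=
  \prod_(i < n) (S (tnth b i).2 - S (tnth b i).1).

Definition step_function (c : seq (C * n.-tuple (R * R)))
    (t : n.-tuple (measurableTypeR R)) : C :=
  \sum_(p <- c) p.1 * box_indic p.2 t.

Definition step_integral (c : seq (C * n.-tuple (R * R))) : A :=
  \sum_(p <- c) p.1 *: box_integral p.2.

(* [is_wigner_integral f X] : [X] is the value at [f] of the isometric extension
   of [step_integral], i.e. f is an L^2-limit of off-diagonal step functions
   whose integrals converge to [X] for the norm of L^2(A, phi). By the isometry
   and the faithfulness of phi there is at most one such [X], and it does not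
   depend on the approximating sequence. *)
Definition is_wigner_integral (f : n.-tuple (measurableTypeR R) -> C) (X : A)
    : Prop :=
  exists c : nat -> seq (C * n.-tuple (R * R)),
    [/\ forall k p, p \in c k -> off_diagonal_box p.2,
        sqr_norm (fun t => f t - step_function (c k) t) @[k --> \oo] --> 0%E &
        complex.Re (phi (vn_star (X - step_integral (c k)) *
                         (X - step_integral (c k)))) @[k --> \oo] --> (0 : R)].

End wigner_integral.

End free_probability.

(* Main.v *)
Require Import Defs.
From mathcomp Require Import all_boot all_order all_algebra.
From mathcomp Require Import complex.
From mathcomp Require Import all_classical all_reals all_analysis.
From mathcomp Require Import measurable_realfun ring lra zify.

Set Implicit Arguments.
Unset Strict Implicit.
Unset Printing Implicit Defensive.

Import Order.TTheory GRing.Theory Num.Theory.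
Import numFieldNormedType.Exports.

(** Write [X] for the integral of [f] and [N] for [phi (X ^+ 2)]. Mirror symmetry
    makes [X] self-adjoint, so [phi (X ^+ 4)] is the squared L^2(phi)-norm of
    [X * X]. The product formula for Wigner integrals decomposes [X * X] into
    orthogonal pieces: the constant [N], the top component, which is the integral
    of f tensor f and has squared norm [N ^+ 2], and the integrals of the
    intermediate contractions of [f] with itself. Hence the fourth moment is
    [2 * N ^+ 2] plus the squared norms of the contractions, and the theorem
    says that these do not all vanish. It suffices to bound [X * X] from below by
    Bessel's inequality, with test vectors detecting the constant, the top
    component, and one part of the component of degree two.

    The test vectors are Wick products. A product of two words of increments,
    where neighbours in each word live on disjoint intervals, has its top
    component obtained by centring the single product at the junction of the two
    words ([wick]). Both sides of the orthogonality relations are multilinear in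
    the increments, so they reduce to increments over the cells of one common
    partition ([incr_free_system]), which are freely independent letters. There
    they follow from the orthogonality of alternating centred products
    ([alternating_orthogonal]) and from the splitting of the square of a letter
    into its variance and the second Chebyshev polynomial
    ([low_degree_orthogonal], [wick_words_ip]). Only the first, second and fourth
    moments of the semicircular law enter ([semicircular_moments]).

    To pass from step integrals to [X], the functionals [phi (T * D)] are
    continuous in [D] for the L^2(phi)-norm, so an identity that is linear in [D]
    and holds for integrals of boxes holds for [X] ([limit_expect0]). Replacing
    the factors of [X * X] one after the other gives its scalar products with
    all Wick products ([square_wick_comb_ip]). The Wick squares of the
    approximating step integrals then recover [N ^+ 2] in the limit
    ([bessel_strict]).

    For the component of degree two, some box [J :: b] has a non-zero scalar
    product with [X]. With [x] the increment over [J] and [s] its variance, the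
    scalar product of [X * X] with the centred square of [x] is the squared norm
    of [x * X] minus [s * N]. The top component of [x * X] already has squared
    norm [s * N], and the box [b] detects a further, orthogonal part of [x * X];
    so the difference is positive ([exists_chaos2_component]). Since [n >= 2], the
    degree two is smaller than the degree [2 * n] of the top component of
    [X * X], so this test vector is orthogonal to the Wick squares.

    The isometry on step functions ([sqr_norm_step]) and the invariance of
    Lebesgue measure under reversal of coordinates ([lebesgueN_rev]) transfer the
    hypotheses on [f] to [X]: it is non-zero ([wigner_neq0]) and self-adjoint
    ([wigner_star]). Finally, a semicircular law of variance [t] has second moment
    [t] and fourth moment [2 * t ^+ 2]. *)

Local Open Scope ring_scope.

(** * The scalar product of a tracial state *)

Section complex_real_part.
Variable R : realType.
Implicit Types z w : R[i].

Lemma ReD z w : complex.Re (z + w) = complex.Re z + complex.Re w.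
Proof. by case: z w => [? ?] [? ?]. Qed.

Lemma ReN z : complex.Re (- z) = - complex.Re z.
Proof. by case: z. Qed.

Lemma Re_sum (I : Type) (r : seq I) (F : I -> R[i]) :
  complex.Re (\sum_(i <- r) F i) = \sum_(i <- r) complex.Re (F i).
Proof. by elim/big_ind2: _ => // _ z _ w <- <-; exact: ReD. Qed.

Lemma conj_sum (I : Type) (r : seq I) (F : I -> R[i]) :
  (\sum_(i <- r) F i)^* = \sum_(i <- r) (F i)^*.
Proof. exact: rmorph_sum. Qed.

Lemma conjM z w : (z * w)^* = z^* * w^*.
Proof. exact: rmorphM. Qed.

Lemma Re_conj z : complex.Re (z^*) = complex.Re z.
Proof. by case: z. Qed.

Lemma conj_real_complex (r : R) : (r%:C%C)^* = r%:C%C.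
Proof. exact: conjc_real. Qed.

Lemma ge0_Re z : 0 <= z -> z = (complex.Re z)%:C%C.
Proof. by case: z => a b; rewrite lecE /= => /andP[/eqP-> _]. Qed.

Lemma mulCconj z : z * z^* = (sqr_modulus z)%:C%C.
Proof.
by case: z => a b; rewrite /sqr_modulus/=; congr Complex; rewrite /=; ring.
Qed.

Lemma sqr_modulus_ge0 z : 0 <= sqr_modulus z.
Proof. by rewrite addr_ge0 ?sqr_ge0. Qed.

Lemma sqr_modulus_eq0 z : (sqr_modulus z == 0) = (z == 0).
Proof.
case: z => a b; rewrite /sqr_modulus paddr_eq0 ?sqr_ge0// !sqrf_eq0.
by rewrite eq_complex.
Qed.

Lemma sqr_modulus_conj z : sqr_modulus (z^*) = sqr_modulus z.
Proof. by case: z => a b; rewrite /sqr_modulus /= sqrrN. Qed.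

End complex_real_part.

Section trace_inner_product.
Local Open Scope classical_set_scope.
Local Open Scope ring_scope.
Variables (R : realType) (A : WstarProbSpace R).
Local Notation C := R[i].
Local Notation phi := (expect A).
Implicit Types (a b c : A) (k : C).

Lemma hdot_inj (H : hilbertSpace R) (x y : H) :
  (forall z, hdot H z x = hdot H z y) -> x = y.
Proof.
move=> h; apply/eqP; rewrite -subr_eq0 -(dnorm_eq0 (hdot H)).
by rewrite linearBr /= h subrr.
Qed.

Lemma vn_opD a b x : vn_op (a + b) x = vn_op a x + vn_op b x.
Proof. by rewrite -[a]scale1r vn_op_linear !scale1r. Qed.

Lemma vn_op0 x : vn_op (0 : A) x = 0.
Proof. by apply: (addrI (vn_op (0 : A) x)); rewrite -vn_opD !addr0. Qed.

Lemma vn_opZ k a x : vn_op (k *: a) x = k *: vn_op a x.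
Proof. by rewrite -[k *: a]addr0 vn_op_linear vn_op0 addr0. Qed.

Lemma vn_op_starr a x y :
  hdot _ x (vn_op (vn_star a) y) = hdot (vn_space A) (vn_op a x) y.
Proof. by rewrite vn_op_star. Qed.

(** The scalar product separates vectors and the representation is faithful,
    so matrix coefficients determine an adjoint. All the rules for the
    involution reduce to this. *)
Lemma starP a b :
  (forall x y, hdot (vn_space A) (vn_op a x) y = hdot _ x (vn_op b y)) ->
  vn_star a = b.
Proof.
by move=> h; apply: vn_op_inj => y; apply: hdot_inj => x; rewrite vn_op_starr h.
Qed.

Lemma starK a : vn_star (vn_star a) = a.
Proof.
apply: starP => x y.
rewrite [LHS]hermC [RHS]hermC /= !expr0 !mul1r; congr (_^*).
by rewrite vn_op_starr.
Qed.

Lemma starD a b : vn_star (a + b) = vn_star a + vn_star b.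
Proof.
by apply: starP => x y; rewrite !vn_opD linearDl linearDr /= !vn_op_starr.
Qed.

Lemma starZ k a : vn_star (k *: a) = k^* *: vn_star a.
Proof.
apply: starP => x y; rewrite !vn_opZ linearZl_LR linearZr_LR /=.
by rewrite !vn_op_starr conjCK.
Qed.

Lemma starM a b : vn_star (a * b) = vn_star b * vn_star a.
Proof. by apply: starP => x y; rewrite !vn_opM !vn_op_starr. Qed.

Lemma star1 : vn_star (1 : A) = 1.
Proof. by apply: starP => x y; rewrite !vn_op1. Qed.

Lemma star0 : vn_star (0 : A) = 0.
Proof. by rewrite -[X in vn_star X](scale0r (0 : A)) starZ rmorph0 scale0r. Qed.

Lemma starN a : vn_star (- a) = - vn_star a.
Proof. by rewrite -scaleN1r starZ rmorphN1 scaleN1r. Qed.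

Lemma starB a b : vn_star (a - b) = vn_star a - vn_star b.
Proof. by rewrite starD starN. Qed.

Lemma star_sum (I : Type) (r : seq I) (F : I -> A) :
  vn_star (\sum_(i <- r) F i) = \sum_(i <- r) vn_star (F i).
Proof. by elim/big_ind2: _ => //; [exact: star0|move=> ? ? ? ? <- <-; exact: starD]. Qed.

Lemma star_prod (I : Type) (r : seq I) (F : I -> A) :
  vn_star (\prod_(i <- r) F i) = \prod_(i <- rev r) vn_star (F i).
Proof.
elim: r => [|i r IH]; first by rewrite !big_nil star1.
by rewrite big_cons starM IH rev_cons -cats1 big_cat big_seq1.
Qed.

Lemma expectD a b : phi (a + b) = phi a + phi b.
Proof. exact: linearD. Qed.

Lemma expectB a b : phi (a - b) = phi a - phi b.
Proof. exact: linearB. Qed.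

Lemma expectZ k a : phi (k *: a) = k * phi a.
Proof. exact: linearZ. Qed.

Lemma expect0 : phi 0 = 0.
Proof. exact: linear0. Qed.

Definition ip a b : C := phi (vn_star b * a).

Definition nrm2 a : R := complex.Re (ip a a).

Lemma ip_nrm2 a : ip a a = (nrm2 a)%:C%C.
Proof. by apply/ge0_Re/expect_ge0. Qed.

Lemma nrm2_ge0 a : 0 <= nrm2 a.
Proof. by have := expect_ge0 a; rewrite -/(ip a a) ip_nrm2 ler0c. Qed.

(** Positivity at [1 + a] and at [1 + 'i *: a] makes [phi (vn_star a) + phi a]
    and ['i * (phi a - phi (vn_star a))] real, and these two facts together
    say that the two values are conjugate. *)
Lemma expect_star a : phi (vn_star a) = (phi a)^*.
Proof.
have h b : complex.Im (phi (vn_star b * b)) = 0.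
  by have := ip_nrm2 b; rewrite /ip => ->.
have h1 : complex.Im (phi (vn_star a) + phi a) = 0.
  have := h (1 + a); rewrite starD star1 mulrDl mul1r mulrDr mulr1.
  rewrite !linearD /= expect1; have := h a.
  by case: (phi _) (phi a) (phi _) => [? ?] [? ?] [? ?] /=; lra.
have h2 : complex.Im ('i%C * (phi a - phi (vn_star a))) = 0.
  have := h (1 + 'i%C *: a); rewrite starD starZ star1.
  rewrite mulrDl mul1r mulrDr mulr1 -scalerAl -scalerAr scalerA.
  rewrite !linearD /= !linearZ /= expect1; have := h a.
  by case: (phi _) (phi a) (phi _) => [? ?] [? ?] [? ?] /=; lra.
move: h1 h2; case: (phi _) (phi a) => [x y] [z t] /= h1 h2.
by congr Complex; lra.
Qed.

Lemma ipC a b : ip b a = (ip a b)^*.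
Proof. by rewrite /ip -expect_star starM starK. Qed.

Lemma ipDl a b c : ip (a + b) c = ip a c + ip b c.
Proof. by rewrite /ip mulrDr linearD. Qed.

Lemma ipZl k a b : ip (k *: a) b = k * ip a b.
Proof. by rewrite /ip -scalerAr linearZ. Qed.

Lemma ipNl a b : ip (- a) b = - ip a b.
Proof. by rewrite -scaleN1r ipZl mulN1r. Qed.

Lemma ipBl a b c : ip (a - b) c = ip a c - ip b c.
Proof. by rewrite ipDl ipNl. Qed.

Lemma ipDr a b c : ip c (a + b) = ip c a + ip c b.
Proof. by rewrite ipC ipDl rmorphD (ipC a c) (ipC b c). Qed.

Lemma ipZr k a b : ip a (k *: b) = k^* * ip a b.
Proof. by rewrite ipC ipZl rmorphM (ipC b a). Qed.

Lemma ipNr a b : ip b (- a) = - ip b a.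
Proof. by rewrite -scaleN1r ipZr rmorphN1 mulN1r. Qed.

Lemma ipBr a b c : ip c (a - b) = ip c a - ip c b.
Proof. by rewrite ipDr ipNr. Qed.

Lemma ip_suml (I : Type) (r : seq I) (F : I -> A) b :
  ip (\sum_(i <- r) F i) b = \sum_(i <- r) ip (F i) b.
Proof. by rewrite /ip mulr_sumr linear_sum. Qed.

Lemma ip_sumr (I : Type) (r : seq I) (F : I -> A) b :
  ip b (\sum_(i <- r) F i) = \sum_(i <- r) ip b (F i).
Proof.
by rewrite ipC ip_suml rmorph_sum; apply: eq_bigr => i _; rewrite (ipC _ b).
Qed.

Lemma nrm2_eq0 a : nrm2 a = 0 -> a = 0.
Proof.
by move=> h; apply: expect_faithful; rewrite -/(ip a a) ip_nrm2 h.
Qed.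

Lemma nrm2Z k a : nrm2 (k *: a) = sqr_modulus k * nrm2 a.
Proof.
apply: complexI; rewrite rmorphM /= -!ip_nrm2 ipZl ipZr mulrA mulCconj.
by rewrite ip_nrm2.
Qed.

Lemma nrm2D a b : nrm2 (a + b) = nrm2 a + nrm2 b + 2 * complex.Re (ip a b).
Proof.
rewrite /nrm2 ipDl !ipDr !ReD (ipC a b) Re_conj; lra.
Qed.

Lemma nrm2N a : nrm2 (- a) = nrm2 a.
Proof. by rewrite /nrm2 ipNl ipNr opprK. Qed.

Lemma nrm2B a b : nrm2 (a - b) = nrm2 a + nrm2 b - 2 * complex.Re (ip a b).
Proof. by rewrite nrm2D nrm2N ipNr ReN mulrN. Qed.

Lemma nrm2_star a : nrm2 (vn_star a) = nrm2 a.
Proof. by rewrite /nrm2 /ip starK expect_tracial. Qed.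

Lemma nrm2D_le a b : nrm2 (a + b) <= 2 * nrm2 a + 2 * nrm2 b.
Proof. by have := nrm2_ge0 (a - b); rewrite nrm2B nrm2D; lra. Qed.

(** Both the Cauchy-Schwarz and the Bessel inequality come from the positivity
    of this squared distance from [a] to the line spanned by [b]. *)
Lemma nrm2_residual a b : nrm2 b != 0 ->
  nrm2 (a - (ip a b * ((nrm2 b)^-1)%:C%C) *: b) =
  nrm2 a - sqr_modulus (ip a b) / nrm2 b.
Proof.
move=> b0; rewrite nrm2B nrm2Z ipZr; case: (ip a b) => x y.
have -> : sqr_modulus ((x +i* y)%C * ((nrm2 b)^-1)%:C%C) =
    sqr_modulus (x +i* y)%C / nrm2 b ^+ 2.
  by rewrite /sqr_modulus /=; field.
have -> : complex.Re (((x +i* y)%C * ((nrm2 b)^-1)%:C%C)^* * (x +i* y)%C) =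
    sqr_modulus (x +i* y)%C / nrm2 b.
  by rewrite /sqr_modulus /=; field.
by field.
Qed.

Lemma ip0r a : ip a 0 = 0.
Proof. by rewrite /ip star0 mul0r expect0. Qed.

Lemma expect_CauchySchwarz a b : sqr_modulus (ip a b) <= nrm2 a * nrm2 b.
Proof.
have [b0|b0] := eqVneq (nrm2 b) 0.
  by rewrite b0 (nrm2_eq0 b0) ip0r mulr0 /sqr_modulus expr0n addr0.
have b_gt0 : 0 < nrm2 b by rewrite lt_def b0 nrm2_ge0.
rewrite -ler_pdivrMr// -subr_ge0 -nrm2_residual//; exact: nrm2_ge0.
Qed.

(** The hypotheses on [Y] say that, in the limit, [Y k] behaves like an
    orthogonal projection of [z] with squared norm [l]; the direction [e],
    orthogonal to all the [Y k], contributes the strict gap. Working with a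
    sequence avoids normalising the test vectors. *)
Lemma bessel_strict (Y : nat -> A) (z e : A) (l : R) :
  (forall m, ip e (Y m) = 0) ->
  complex.Re (ip z (Y m)) @[m --> \oo] --> l ->
  nrm2 (Y m) @[m --> \oo] --> l ->
  ip z e != 0 -> l < nrm2 z.
Proof.
move=> eY zY YY ze.
have e0 : nrm2 e != 0.
  by apply: contra_neq ze => /nrm2_eq0 ->; rewrite ip0r.
pose q := sqr_modulus (ip z e) / nrm2 e.
have q0 : 0 < q.
  rewrite divr_gt0//; last by rewrite lt_def e0 nrm2_ge0.
  by rewrite lt_def sqr_modulus_eq0 ze sqr_modulus_ge0.
have bound m : 2 * complex.Re (ip z (Y m)) - nrm2 (Y m) <= nrm2 z - q.
  rewrite -nrm2_residual//; set u := z - _.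
  (* Subtracting from [z] its component along [e] changes no scalar product
     with [Y m]. *)
  have -> : ip z (Y m) = ip u (Y m) by rewrite /u ipBl ipZl eY mulr0 subr0.
  by have := nrm2_ge0 (u - Y m); rewrite nrm2B; lra.
have lim : 2 * complex.Re (ip z (Y m)) - nrm2 (Y m) @[m --> \oo] --> 2 * l - l.
  by apply: cvgB => //; apply: cvgM => //; exact: cvg_cst.
have : 2 * l - l <= nrm2 z - q.
  by apply: (cvgr_to_le lim); near=> m; exact: bound.
by lra.
Unshelve. all: by end_near. Qed.

End trace_inner_product.

(** * Moments of the semicircular law *)

Section density.
Local Open Scope classical_set_scope.
Local Open Scope ring_scope.
Local Open Scope ereal_scope.
Context d (T : measurableType d) (R : realType).
Variables (mu nu : {measure set T -> \bar R}) (p : T -> R).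
Hypothesis p_ge0 : forall x, (0 <= p x)%R.
Hypothesis mp : measurable_fun setT p.
Hypothesis nuE : forall U, measurable U -> nu U = \int[mu]_(x in U) (p x)%:E.

Import HBNNSimple.

(** Both sides are monotone limits along simple functions, and on a simple
    function the identity is the definition of [nu] on level sets. *)
Lemma ge0_integral_density (f : T -> \bar R) : (forall x, 0 <= f x) ->
  measurable_fun setT f -> \int[nu]_x f x = \int[mu]_x (f x * (p x)%:E).
Proof.
move=> f0 mf; pose h := nnsfun_approx measurableT mf.
have mpE : measurable_fun setT (fun x => (p x)%:E) by exact/measurable_EFinP.
have cvh x : EFin (h n x) @[n --> \oo] --> f x.
  exact: (cvg_nnsfun_approx measurableT mf (fun x _ => f0 x)).
have simple n : \int[nu]_x (h n x)%:E = \int[mu]_x ((h n x)%:E * (p x)%:E).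
  rewrite integralT_nnsfun sintegralE.
  under [RHS]eq_integral => x _.
    rewrite (fimfunE (h n) x) -fsumEFin// ge0_mule_fsuml; last first.
      by move=> r; exact: nnfun_muleindic_ge0.
    over.
  rewrite ge0_integral_fsum//=; last 2 first.
    move=> r; apply: emeasurable_funM => //; apply/measurable_EFinP.
    exact: measurable_funM.
  by move=> r x _; rewrite mule_ge0 ?lee_fin// -lee_fin EFinM nnfun_muleindic_ge0.
  apply: eq_fsbigr => r /[!inE] -[y _ hy].
  have r0 : (0 <= r)%R by rewrite -hy.
  under eq_integral do rewrite EFinM -muleA.
  rewrite ge0_integralZl//; last 2 first.
    by apply: emeasurable_funM => //; exact/measurable_EFinP.
  by move=> x _; rewrite -EFinM lee_fin mulr_ge0.
  congr (_ * _); rewrite nuE// integral_mkcond; apply: eq_integral => x _.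
  rewrite patchE indicE; case: ifPn => _; first by rewrite mul1e.
  by rewrite mul0e.
have nd x : {homo (fun n => (h n x)%:E) : a b / (a <= b)%N >-> a <= b}.
  by move=> a b ab; rewrite lee_fin; exact/lefP/nd_nnsfun_approx.
have -> : \int[nu]_x f x = lim (\int[nu]_x (h n x)%:E @[n --> \oo]).
  rewrite -monotone_convergence//; last 2 first.
    by move=> n; apply/measurable_EFinP.
  by move=> n x _; rewrite lee_fin.
  by apply: eq_integral => x _; apply/esym/cvg_lim.
rewrite (_ : (fun n => _) = (fun n => \int[mu]_x ((h n x)%:E * (p x)%:E))); last first.
  by apply/funext => n; rewrite simple.
rewrite -monotone_convergence//; last 3 first.
- by move=> n; apply: emeasurable_funM => //; exact/measurable_EFinP.
- by move=> n x _; rewrite -EFinM lee_fin mulr_ge0.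
- by move=> x _ a b ab; rewrite lee_wpmul2r ?lee_fin//; exact/lefP/nd_nnsfun_approx.
apply: eq_integral => x _; apply/cvg_lim => //.
by apply: cvgeZr => //; exact: cvh.
Qed.

Lemma integral_density (f : T -> \bar R) : nu.-integrable setT f ->
  \int[nu]_x f x = \int[mu]_x (f x * (p x)%:E).
Proof.
move=> /integrableP[mf fi].
have mpE : measurable_fun setT (fun x => (p x)%:E) by exact/measurable_EFinP.
have pE0 x : 0 <= (p x)%:E by rewrite lee_fin.
have fp := ge0_integral_density (@funepos_ge0 _ _ f) (measurable_funepos mf).
have fn := ge0_integral_density (@funeneg_ge0 _ _ f) (measurable_funeneg mf).
rewrite integralE fp fn [RHS]integralE; congr (_ - _); apply: eq_integral => x _.
  by rewrite !funeposE ![_ * (p x)%:E]muleC maxe_pMr// mule0.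
by rewrite !funenegE ![_ * (p x)%:E]muleC maxe_pMr// mule0 muleN.
Qed.

End density.

Section semicircle_moments.
Local Open Scope classical_set_scope.
Local Open Scope ring_scope.
Variable R : realType.
Implicit Types (t c x : R).

(** The integrand is the derivative of [q x * (c ^+ 2 - x ^+ 2) * Num.sqrt (c
    ^+ 2 - x ^+ 2)], which vanishes at both ends of the interval. *)
Lemma semicircle_ibp c (q dq : R -> R) : 0 < c ->
  (forall x, is_derive x 1 q (dq x)) -> continuous dq ->
  (\int[lebesgue_measure]_(x in `[(- c)%R, c])
     ((dq x * (c ^+ 2 - x ^+ 2) - 3 * x * q x) * Num.sqrt (c ^+ 2 - x ^+ 2))%R%:E
   = 0)%E.
Proof.
move=> c0 dq_ cdq; pose w x := c ^+ 2 - x ^+ 2.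
pose F x := q x * (w x * Num.sqrt (w x)).
have cq : continuous q.
  by move=> x; apply: differentiable_continuous; apply/derivable1_diffP; have [] := dq_ x.
have cw : continuous w.
  by move=> x; apply: cvgB; [exact: cvg_cst|exact: exprn_continuous].
have csw : continuous (fun x => Num.sqrt (w x)).
  by move=> x; apply: (continuous_comp (cw x)); exact: sqrt_continuous.
have cF : continuous F.
  by move=> x; apply: cvgM; [exact: cq|apply: cvgM; [exact: cw|exact: csw]].
have dF x : x \in `]- c, c[ -> is_derive x 1 F ((dq x * w x - 3 * x * q x) * Num.sqrt (w x)).
  rewrite in_itv /= => /andP[cx xc].
  have w0 : 0 < w x by rewrite /w subr_sqr mulr_gt0; lra.
  have dw : is_derive x 1 w (- (2 * x)).
    rewrite /w; apply: is_derive_eq.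
    by rewrite /GRing.scale /=; ring.
  have ds : is_derive x 1 (fun y => Num.sqrt (w y)) ((2 * Num.sqrt (w x))^-1 * - (2 * x)).
    have ds0 := is_derive1_sqrt w0.
    exact: is_derive1_comp ds0 dw.
  have dqx := dq_ x.
  rewrite /F; apply: is_derive_eq.
  have s0 : 0 < Num.sqrt (w x) by rewrite sqrtr_gt0.
  have := sqr_sqrtr (ltW w0); rewrite /GRing.scale /=; move: s0; set s := Num.sqrt _ => s0 <-.
  by field; rewrite gt_eqF.
rewrite (continuous_FTC2 (F := F)).
- by rewrite /F /w /= sqrrN !(subrr, mul0r, mulr0) -EFinB subrr.
- by lra.
- apply: continuous_subspaceT => x; apply: cvgM; last exact: csw.
  apply: cvgB; first by apply: cvgM; [exact: cdq|exact: cw].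
  by apply: cvgM; [apply: cvgM; [exact: cvg_cst|exact: cvg_id]|exact: cq].
- split.
  + by move=> x /dF[].
  + by apply: cvg_at_right_filter; exact: cF.
  + by apply: cvg_at_left_filter; exact: cF.
- by move=> x /dF dFx; rewrite derive1E derive_val.
Qed.

(** Outside of the support the argument of the square root is negative, where
    [Num.sqrt] is zero, so the case distinction is absorbed. *)
Lemma semicircular_pdfE t x : 0 < t ->
  semicircular_pdf t x = Num.sqrt (4 * t - x ^+ 2) / (2 * pi * t).
Proof.
move=> t0; rewrite /semicircular_pdf; case: ifPn => //.
rewrite -ltNge => xt; rewrite ler0_sqrtr ?mul0r//.
rewrite subr_le0 -[x ^+ 2]real_normK ?num_real// -[4 * t]sqr_sqrtr; last lra.
have -> : Num.sqrt (4 * t) = 2 * Num.sqrt t.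
  by rewrite sqrtrM// (_ : 4 = 2 ^+ 2) ?sqrtr_sqr ?ger0_norm// -natrX.
by rewrite ler_sqr ?nnegrE ?mulr_ge0 ?sqrtr_ge0// ltW.
Qed.

(** With [q] a power of [x], this is a recursion between moments. *)
Lemma semicircular_stein t (q dq : R -> R) : 0 < t ->
  (forall x, is_derive x 1 q (dq x)) -> continuous dq ->
  (semicircular t).-integrable setT
    (EFin \o (fun x : measurableTypeR R => dq x * (4 * t - x ^+ 2) - 3 * x * q x)) ->
  \int[semicircular t]_x (dq x * (4 * t - x ^+ 2) - 3 * x * q x) = 0.
Proof.
move=> t0 dq_ cdq intg; rewrite /Rintegral.
rewrite (integral_density (mu := lebesgue_measure) (p := semicircular_pdf t))//.
- pose c := 2 * Num.sqrt t.
  have c2 : c ^+ 2 = 4 * t by rewrite exprMn sqr_sqrtr ?ltW// -natrX.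
  have c0 : 0 < c by rewrite mulr_gt0 ?sqrtr_gt0.
  pose k := (2 * pi * t)^-1.
  have dkq x : is_derive x 1 (fun y => k * q y) (k * dq x).
    by have dqx := dq_ x; apply: is_derive_eq; rewrite /GRing.scale /=; ring.
  have ckdq : continuous (fun y => k * dq y).
    by move=> x; apply: cvgM; [exact: cvg_cst|exact: cdq].
  rewrite -[RHS]/(fine 0%E) -(semicircle_ibp c0 dkq ckdq) c2; congr fine.
  rewrite [RHS]integral_mkcond; apply: eq_integral => x _.
  rewrite patchE semicircular_pdfE//; case: ifPn => xc /=.
    by rewrite -EFinM; congr EFin; rewrite /k; ring.
  rewrite -EFinM ler0_sqrtr ?mul0r ?mulr0//.
  rewrite subr_le0 -c2; move: xc; apply: contraNT.
  rewrite -ltNge -[x ^+ 2]real_normK ?num_real// ltr_sqr ?nnegrE ?normr_ge0 ?(ltW c0)//.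
  by rewrite ltr_norml inE/= in_itv/= => /andP[/ltW-> /ltW->].
- move=> x; rewrite semicircular_pdfE// divr_ge0 ?sqrtr_ge0// !mulr_ge0 ?pi_ge0//.
  exact: ltW.
- exact: measurable_semicircular_pdf.
Qed.

(** Writing [M m] for the moments, the choices [1], [x] and [x ^+ 3] of [q]
    give [M 1 = 0], [M 2 = t * M 0] and [M 4 = 2 * t * M 2], while [M 0 = 1]
    because the law computes [phi 1]. *)
Lemma semicircular_moments (A : WstarProbSpace R) (X : A) t : 0 < t ->
  is_law X (semicircular t) ->
  [/\ expect A X = 0, expect A (X * X) = t%:C%C
    & expect A (X * X * (X * X)) = 2 * t%:C%C ^+ 2].
Proof.
move=> t0 law; pose nu := semicircular t.
pose M m := \int[nu]_x ((x : R) ^+ m).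
have im m : nu.-integrable setT (fun x : measurableTypeR R => ((x : R) ^+ m)%:E).
  by have [] := law m.
have iZ k m : nu.-integrable setT (fun x : measurableTypeR R => (k * (x : R) ^+ m)%:E).
  by under eq_fun do rewrite EFinM; exact: integrableZl.
have ME m : (M m)%:C%C = expect A (X ^+ m) by have [] := law m.
have MZ k m : \int[nu]_x (k * (x : R) ^+ m) = k * M m.
  by rewrite RintegralZl//; exact: im.
have MB k m l p : \int[nu]_x (k * (x : R) ^+ m - l * x ^+ p) = k * M m - l * M p.
  by rewrite RintegralB ?MZ//; exact: iZ.
have iB k m l p : nu.-integrable setT
    (EFin \o (fun x : measurableTypeR R => k * (x : R) ^+ m - l * x ^+ p)).
  by apply: (integrableB _ (iZ k m) (iZ l p)).
have M0 : M 0%N = 1.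
  by apply: complexI; rewrite ME expr0 expect1.
have M1 : M 1%N = 0.
  have e : (fun x : measurableTypeR R => 0 * (4 * t - x ^+ 2) - 3 * x * 1) =
    (fun x => 0 * x ^+ 0 - 3 * x ^+ 1) by apply/funext => x; ring.
  have := @semicircular_stein t (fun=> 1) (fun=> 0) t0 (fun x => is_derive_cst _ _ _)
    (@cst_continuous _ _ _).
  rewrite e MB => /(_ (iB _ _ _ _)); lra.
have M2 : M 2%N = t.
  have e : (fun x : measurableTypeR R => 1 * (4 * t - x ^+ 2) - 3 * x * x) =
    (fun x => 4 * t * x ^+ 0 - 4 * x ^+ 2) by apply/funext => x; ring.
  have := @semicircular_stein t id (fun=> 1) t0 (fun x => is_derive_id _ _)
    (@cst_continuous _ _ _).
  rewrite e MB M0 => /(_ (iB _ _ _ _)); lra.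
have M4 : M 4%N = 2 * t ^+ 2.
  have e : (fun x : measurableTypeR R => 3 * x ^+ 2 * (4 * t - x ^+ 2) - 3 * x * x ^+ 3) =
    (fun x => 12 * t * x ^+ 2 - 6 * x ^+ 4) by apply/funext => x; ring.
  have := @semicircular_stein t (fun x => x ^+ 3) (fun x => 3 * x ^+ 2) t0.
  rewrite e MB M2 => h.
  suff : 12 * t * t - 6 * M 4%N = 0 by lra.
  apply: h => //; last by move=> x; apply: cvgM; [exact: cvg_cst|exact: exprn_continuous].
  by move=> x; apply: is_derive_eq; rewrite /GRing.scale /=; ring.
split.
- by rewrite -[X]expr1 -ME M1.
- by rewrite -expr2 -ME M2.
- by rewrite -!expr2 -exprM -ME M4 rmorphM rmorphXn /= rmorph_nat.
Qed.

End semicircle_moments.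

(** * Alternating products of free letters *)

Section generated_algebra.
Variables (R : realType) (A : WstarProbSpace R) (a : A).

Lemma generated_algebra_closed : GRing.subalg_closed [in generated_algebra a].
Proof.
split.
- by rewrite inE => B [cB _]; have [+ _ _] := cB; rewrite inE.
- move=> k x y; rewrite !inE => hx hy B BP.
  by have [[_ + _] _] := BP => /(_ k x y); rewrite !inE; apply; [exact: hx|exact: hy].
- move=> x y; rewrite !inE => hx hy B BP.
  by have [[_ _ +] _] := BP => /(_ x y); rewrite !inE; apply; [exact: hx|exact: hy].
Qed.

Lemma generated_algebra_gen : generated_algebra a a.
Proof. by move=> B [_]; exact. Qed.

Lemma generated_algebra1 : generated_algebra a 1.
Proof. by have [+ _ _] := generated_algebra_closed; rewrite inE. Qed.

Lemma generated_algebraM x y : generated_algebra a x -> generated_algebra a y ->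
  generated_algebra a (x * y).
Proof.
by have [_ _ h] := generated_algebra_closed; move: (h x y); rewrite !inE; exact.
Qed.

Lemma generated_algebraBZ1 x k : generated_algebra a x ->
  generated_algebra a (x - k *: 1).
Proof.
have [_ h _] := generated_algebra_closed => ax.
have := h (- k) 1 x; rewrite !inE scaleNr addrC; apply => //.
exact: generated_algebra1.
Qed.

End generated_algebra.

Section free_words.
Variables (R : realType) (A : WstarProbSpace R).
Local Notation C := R[i].
Local Notation phi := (expect A).
Variables (I : finType) (x : I -> A) (v : I -> R).
Hypothesis x_free : freely_independent (fun i => generated_algebra (x i)).
Hypothesis x_star : forall i, vn_star (x i) = x i.
Hypothesis x_mean : forall i, phi (x i) = 0.
Hypothesis x_var : forall i, phi (x i * x i) = (v i)%:C%C.
Hypothesis x_fourth : forall i, phi (x i * x i * (x i * x i)) = 2 * (v i)%:C%C ^+ 2.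

Implicit Types (u e : seq (I * A)) (w : seq I).

(** Freeness speaks of sequences whose consecutive labels differ; stated as a
    relation, it gives access to the theory of [sorted]. *)
Definition neq_labels (i j : I) := i != j.

Lemma neq_labels_sym i j : neq_labels i j = neq_labels j i.
Proof. by rewrite /neq_labels eq_sym. Qed.

Definition alternating u := sorted neq_labels (map fst u).

Definition centred u :=
  forall p, p \in u -> generated_algebra (x p.1) p.2 /\ phi p.2 = 0.

Definition self_adjoint u := forall p, p \in u -> vn_star p.2 = p.2.

Definition labelled_prod u : A := \prod_(p <- u) p.2.

Lemma alternating_expect0 u : u != [::] -> alternating u -> centred u ->
  phi (labelled_prod u) = 0.
Proof.
case: u => // p u _ alt cen; rewrite /labelled_prod (big_nth p) big_mkord.
apply: (x_free (m := size u) (i := fun j => (nth p (p :: u) j).1)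
  (X := fun j => (nth p (p :: u) j).2)).
- by move=> j; apply: (cen _ _).1; apply: mem_nth; exact: ltn_ord.
- by move=> j; apply: (cen _ _).2; apply: mem_nth; exact: ltn_ord.
- move=> j k kj; move: alt => /(pathP p.1) /(_ j).
  rewrite size_map -ltnS -kj => /(_ (ltn_ord k)).
  rewrite -[p.1 :: _]/(map fst (p :: u)) !(nth_map p) ?ltn_ord//; last first.
    by rewrite -ltnS -kj.
  by rewrite kj /= => /eqP.
Qed.

(** The value of the scalar product of two alternating products, by
    [alternating_orthogonal]. *)
Fixpoint pairing u e : C :=
  match u, e with
  | [::], [::] => 1
  | p :: u', q :: e' =>
      if p.1 == q.1 then phi (p.2 * q.2) * pairing u' e' else 0
  | _, _ => 0
  end.

Lemma pairing_size u e : size u != size e -> pairing u e = 0.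
Proof.
elim: u e => [|p u IH] [|q e] //= s; case: ifP => // _.
by rewrite IH ?mulr0.
Qed.

Lemma pairing_cat u u' e e' : size u = size e ->
  pairing (u ++ u') (e ++ e') = pairing u e * pairing u' e'.
Proof.
elim: u e => [|p u IH] [|q e] //= s; first by rewrite mul1r.
case: ifP => // _; last by rewrite mul0r.
by rewrite IH ?mulrA//; case: s.
Qed.

Lemma labelled_prod_cons p u : labelled_prod (p :: u) = p.2 * labelled_prod u.
Proof. by rewrite /labelled_prod big_cons. Qed.

Lemma labelled_prod_cat u e : labelled_prod (u ++ e) = labelled_prod u * labelled_prod e.
Proof. by rewrite /labelled_prod big_cat. Qed.

Lemma labelled_prod_rev_cons p u : labelled_prod (rev (p :: u)) = labelled_prod (rev u) * p.2.
Proof. by rewrite /labelled_prod rev_cons -cats1 big_cat big_seq1. Qed.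

Lemma labelled_prod_star u : self_adjoint u -> vn_star (labelled_prod u) = labelled_prod (rev u).
Proof.
move=> sa; rewrite /labelled_prod star_prod; apply: eq_big_seq => p.
by rewrite mem_rev => /sa.
Qed.

Lemma sorted_rev_cat (T : eqType) (r : rel T) (s t : seq T) y :
  symmetric r -> sorted r (rev s ++ y :: t) = sorted r (y :: s) && sorted r (y :: t).
Proof.
move=> rS; rewrite sorted_cat_cons -rev_cons rev_sorted; congr (_ && _).
by apply: eq_sorted => a b; rewrite rS.
Qed.

Lemma sorted_tl (T : eqType) (r : rel T) (s : seq T) y :
  sorted r (y :: s) -> sorted r s.
Proof. by move=> /path_sorted. Qed.

(** Look at the two factors [p] and [q] that meet in the middle. If their
    labels differ, the whole product is alternating and centred, so its
    expectation is zero. If they agree, [p * q] is its expectation plus a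
    centred element of the same algebra; the centred element again yields an
    alternating product, and the expectation factors out of a shorter
    instance. *)
Lemma alternating_orthogonal u e :
  alternating u -> alternating e -> centred u -> centred e ->
  phi (labelled_prod (rev u) * labelled_prod e) = pairing u e.
Proof.
elim: u e => [|p u IH] e au ae cu ce.
  case: e ae ce => [|q e] ae ce /=.
    by rewrite /labelled_prod /rev /= !big_nil mulr1 expect1.
  by rewrite {1}/labelled_prod /rev /= big_nil mul1r alternating_expect0.
case: e ae ce => [|q e] ae ce /=.
  rewrite {2}/labelled_prod big_nil mulr1; apply: alternating_expect0.
  - by rewrite -size_eq0 size_rev.
  - rewrite /alternating map_rev rev_sorted.
    by rewrite (eq_sorted (e' := neq_labels))// => a b /=; rewrite neq_labels_sym.
  - by move=> z; rewrite mem_rev; exact: cu.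
have cu' : centred u by move=> z zu; apply: cu; rewrite inE zu orbT.
have ce' : centred e by move=> z zu; apply: ce; rewrite inE zu orbT.
case: ifPn => pq; last first.
  rewrite -labelled_prod_cat; apply: alternating_expect0.
  - by rewrite -size_eq0 size_cat addnS.
  - rewrite /alternating map_cat map_rev /= sorted_rev_cat; last exact: neq_labels_sym.
    by rewrite [X in _ && X]ae andbT /= neq_labels_sym [neq_labels _ _]pq.
  - by move=> z; rewrite mem_cat mem_rev => /orP[/cu|/ce].
have -> : labelled_prod (rev (p :: u)) * labelled_prod (q :: e) =
    labelled_prod (rev u ++ (p.1, p.2 * q.2 - phi (p.2 * q.2) *: 1) :: e)
    + phi (p.2 * q.2) *: (labelled_prod (rev u) * labelled_prod e).
  rewrite labelled_prod_rev_cons labelled_prod_cat !labelled_prod_cons /= mulrBl mulrBr.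
  by rewrite -scalerAl mul1r -scalerAr subrK !mulrA.
rewrite expectD expectZ (IH e)//; last first.
- exact: sorted_tl ae.
- exact: sorted_tl au.
rewrite alternating_expect0 ?add0r//.
- by rewrite -size_eq0 size_cat addnS.
- rewrite /alternating map_cat map_rev /= sorted_rev_cat; last exact: neq_labels_sym.
  by apply/andP; split; [exact: au|rewrite (eqP pq); exact: ae].
- move=> z; rewrite mem_cat mem_rev inE => /or3P[/cu'//|/eqP->|/ce'//] /=.
  split.
    apply: generated_algebraBZ1; apply: generated_algebraM.
      by apply: (cu p _).1; rewrite mem_head.
    by rewrite (eqP pq); apply: (ce q _).1; rewrite mem_head.
  by rewrite expectB expectZ expect1 mulr1 subrr.
Qed.

(** The second Chebyshev polynomial of the semicircular law of variance [v i],
    evaluated at the letter: the part of its square that is orthogonal to the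
    constants. *)
Definition cheb2 i : A := x i * x i - (v i)%:C%C *: 1.

Definition word_prod w : A := \prod_(i <- w) x i.
Definition letters w : seq (I * A) := [seq (i, x i) | i <- w].

Lemma labelled_prod_letters w : labelled_prod (letters w) = word_prod w.
Proof. by rewrite /labelled_prod /letters big_map. Qed.

Lemma letters_fst w : map fst (letters w) = w.
Proof. by rewrite /letters -map_comp map_id. Qed.

Lemma letters_centred w : centred (letters w).
Proof.
by move=> _ /mapP[i _ ->]; split; [exact: generated_algebra_gen|exact: x_mean].
Qed.

Lemma letters_self_adjoint w : self_adjoint (letters w).
Proof. by move=> _ /mapP[i _ ->]; exact: x_star. Qed.

Lemma cheb2_star i : vn_star (cheb2 i) = cheb2 i.
Proof. by rewrite /cheb2 starB starZ starM x_star star1 conj_real_complex. Qed.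

Lemma cheb2_mem i : generated_algebra (x i) (cheb2 i).
Proof. by apply: generated_algebraBZ1; apply: generated_algebraM; exact: generated_algebra_gen. Qed.

Lemma cheb2_mean i : phi (cheb2 i) = 0.
Proof. by rewrite expectB expectZ x_var expect1 mulr1 subrr. Qed.

Lemma cheb2_sqr i : phi (cheb2 i * cheb2 i) = (v i)%:C%C ^+ 2.
Proof.
rewrite /cheb2 mulrBr mulrBl -scalerAl -!scalerAr mul1r mulr1.
rewrite expectB expectZ -/(cheb2 i) cheb2_mean mulr0 subr0.
rewrite expectB expectZ x_fourth x_var; ring.
Qed.

(** The alternating factors of the centred product of two letters. *)
Definition junction i j : seq (I * A) :=
  if i == j then [:: (i, cheb2 i)] else [:: (i, x i); (j, x j)].

(** The alternating factors of the top component of [word_prod (rev (i :: b))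
    * word_prod (j :: b')]. The first word is given reversed so that the
    letters meeting at the junction are the heads of both lists. *)
Definition wick_list b i j b' := letters (rev b) ++ junction i j ++ letters b'.

Lemma letters_covariance i j : phi (x i * x j) = if i == j then (v i)%:C%C else 0.
Proof.
case: eqVneq => [->|ij]; first exact: x_var.
have := @alternating_expect0 (letters [:: i; j]).
rewrite /labelled_prod /letters /= !big_cons big_nil mulr1; apply => //.
  by rewrite /alternating /= andbT.
exact: (@letters_centred [:: i; j]).
Qed.

Lemma wick_listE b i j b' :
  labelled_prod (wick_list b i j b') =
  word_prod (rev b) * (x i * x j - phi (x i * x j) *: 1) * word_prod b'.
Proof.
rewrite /wick_list !labelled_prod_cat !labelled_prod_letters mulrA; congr (_ * _ * _).
rewrite letters_covariance /junction; case: eqVneq => [->|ij].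
  by rewrite /labelled_prod big_seq1.
by rewrite /labelled_prod !big_cons big_nil mulr1 scale0r subr0.
Qed.

Lemma wick_list_self_adjoint b i j b' : self_adjoint (wick_list b i j b').
Proof.
move=> p; rewrite !mem_cat /junction => /or3P[|/[dup]|].
- exact: letters_self_adjoint.
- case: ifP => _ _; rewrite !inE; first by move/eqP->; exact: cheb2_star.
  by move=> /orP[]/eqP->; exact: x_star.
- exact: letters_self_adjoint.
Qed.

Lemma wick_list_centred b i j b' : centred (wick_list b i j b').
Proof.
move=> p; rewrite !mem_cat /junction => /or3P[|/[dup]|].
- exact: letters_centred.
- case: ifP => _ _; rewrite !inE.
    by move/eqP->; split; [exact: cheb2_mem|exact: cheb2_mean].
  by move=> /orP[]/eqP->; split; rewrite ?x_mean//; exact: generated_algebra_gen.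
- exact: letters_centred.
Qed.

Lemma wick_list_alternating b i j b' : sorted neq_labels (i :: b) ->
  sorted neq_labels (j :: b') -> alternating (wick_list b i j b').
Proof.
move=> bi bj; rewrite /alternating /wick_list /junction.
case: eqVneq => [ij|ij]; rewrite !map_cat !letters_fst /=.
  rewrite sorted_rev_cat; last exact: neq_labels_sym.
  by rewrite bi ij.
rewrite sorted_rev_cat; last exact: neq_labels_sym.
by rewrite bi /= {1}/neq_labels ij.
Qed.

Lemma wick_list_size b i j b' :
  size (wick_list b i j b') = (size b + size b' + (i != j).+1)%N.
Proof.
rewrite /wick_list /junction !size_cat !size_map size_rev.
by case: eqVneq => _ /=; lia.
Qed.

Lemma word_prod_rev_cons i w : word_prod (rev (i :: w)) = word_prod (rev w) * x i.
Proof. by rewrite /word_prod rev_cons -cats1 big_cat big_seq1. Qed.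

Lemma word_prod_cons i w : word_prod (i :: w) = x i * word_prod w.
Proof. by rewrite /word_prod big_cons. Qed.

(** When the letters at the junction agree, the square of the letter is a
    Chebyshev polynomial plus the variance, which contracts the two words. *)
Lemma junction_expand i d d' :
  word_prod (rev (i :: d)) * word_prod (i :: d') =
  labelled_prod (wick_list d i i d') + (v i)%:C%C *: (word_prod (rev d) * word_prod d').
Proof.
rewrite wick_listE x_var word_prod_rev_cons word_prod_cons mulrBr mulrBl.
by rewrite -!scalerAr mulr1 -scalerAl subrK !mulrA.
Qed.

Lemma junction_split i j d d' : i != j ->
  word_prod (rev (i :: d)) * word_prod (j :: d') = labelled_prod (wick_list d i j d').
Proof.
move=> ij; rewrite wick_listE word_prod_rev_cons word_prod_cons letters_covariance (negbTE ij).
by rewrite scale0r subr0 !mulrA.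
Qed.

(** Expanding the junction of the two words repeatedly writes their product as
    a combination of alternating products of at most [size d + size d']
    factors, and alternating products with different numbers of factors are
    orthogonal. *)
Lemma low_degree_orthogonal e d d' : alternating e -> centred e ->
  sorted neq_labels d -> sorted neq_labels d' -> (size d + size d' < size e)%N ->
  phi (labelled_prod (rev e) * (word_prod (rev d) * word_prod d')) = 0.
Proof.
move=> ae ce; elim: d d' => [|i d IH] d' sd sd' lt.
  rewrite {1}/word_prod /rev /= big_nil mul1r -labelled_prod_letters.
  rewrite alternating_orthogonal ?pairing_size//.
  - by rewrite size_map neq_ltn lt orbT.
  - by rewrite /alternating letters_fst.
  - exact: letters_centred.
case: d' sd' lt => [|j d'] sd' lt.
  rewrite {2}/word_prod big_nil mulr1 -labelled_prod_letters.
  rewrite alternating_orthogonal ?pairing_size//.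
  - by rewrite size_map size_rev; move: lt; rewrite addn0 neq_ltn orbC => ->.
  - rewrite /alternating letters_fst rev_sorted.
    by rewrite (eq_sorted (e' := neq_labels))// => a b /=; rewrite neq_labels_sym.
  - exact: letters_centred.
have ps : forall i j, pairing e (wick_list d i j d') = 0.
  move=> a b; apply: pairing_size; rewrite wick_list_size.
  by move: lt => /=; case: (a != b); lia.
have [ij|ij] := eqVneq i j; last first.
  rewrite junction_split// alternating_orthogonal//.
  - exact: wick_list_alternating.
  - exact: wick_list_centred.
subst j; rewrite junction_expand mulrDr expectD -scalerAr expectZ.
rewrite IH ?mulr0 ?addr0//.
- rewrite alternating_orthogonal//.
  + exact: wick_list_alternating.
  + exact: wick_list_centred.
- exact: sorted_tl sd.
- exact: sorted_tl sd'.
- by move: lt => /=; lia.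
Qed.

Lemma pairing_letters w w' :
  pairing (letters w) (letters w') = (w == w')%:R * \prod_(i <- w) (v i)%:C%C.
Proof.
elim: w w' => [|i w IH] [|j w'] /=; rewrite ?big_nil ?mul1r ?mul0r//.
rewrite eqseq_cons IH letters_covariance; case: eqVneq => [_|] /=; last by rewrite mul0r.
by rewrite big_cons; ring.
Qed.

Lemma words_ip w w' : sorted neq_labels w -> sorted neq_labels w' ->
  ip (word_prod w') (word_prod w) = pairing (letters w) (letters w').
Proof.
move=> sw sw'; rewrite /ip -labelled_prod_letters labelled_prod_star;
  last exact: letters_self_adjoint.
rewrite -labelled_prod_letters alternating_orthogonal//; try exact: letters_centred;
  by rewrite /alternating letters_fst.
Qed.

(** In the product of the words [k :: d] and [l :: d'] every contracted term
    has too few factors to pair with the Wick product; the remaining term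
    pairs position by position, except that two letters at the junction count
    for one factor when they agree. The numbers of factors therefore match
    only if both junctions are of the same kind. *)
Lemma wick_words_ip b i j b' d k l d' :
  size b = size d -> size b' = size d' ->
  sorted neq_labels (i :: b) -> sorted neq_labels (j :: b') ->
  sorted neq_labels (k :: d) -> sorted neq_labels (l :: d') ->
  ip (word_prod (rev (k :: d)) * word_prod (l :: d')) (labelled_prod (wick_list b i j b')) =
  ip (word_prod (rev (k :: d))) (word_prod (rev (i :: b))) *
  ip (word_prod (l :: d')) (word_prod (j :: b')).
Proof.
move=> sz sz' sb sb' sd sd'.
have srev s : sorted neq_labels s -> sorted neq_labels (rev s).
  rewrite rev_sorted => ss.
  by rewrite (eq_sorted (e' := neq_labels))// => a c /=; rewrite neq_labels_sym.
have aw p s q t := @wick_list_alternating p s q t.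
have -> : ip (word_prod (rev (k :: d)) * word_prod (l :: d')) (labelled_prod (wick_list b i j b')) =
    pairing (wick_list b i j b') (wick_list d k l d').
  rewrite /ip labelled_prod_star; last exact: wick_list_self_adjoint.
  have key : phi (labelled_prod (rev (wick_list b i j b')) * labelled_prod (wick_list d k l d'))
      = pairing (wick_list b i j b') (wick_list d k l d').
    by rewrite alternating_orthogonal//; solve [exact: aw|exact: wick_list_centred].
  have [kl|kl] := eqVneq k l; last by rewrite junction_split.
  subst l; rewrite junction_expand mulrDr expectD -scalerAr expectZ key.
  rewrite low_degree_orthogonal ?mulr0 ?addr0//.
  - exact: aw.
  - exact: wick_list_centred.
  - exact: sorted_tl sd.
  - exact: sorted_tl sd'.
  - by rewrite wick_list_size; case: (i != j); lia.
rewrite !words_ip//; try exact: srev.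
rewrite /wick_list pairing_cat; last by rewrite !size_map !size_rev.
rewrite [in RHS]/letters !rev_cons !map_rcons -!cats1 -!/(letters _).
rewrite [in RHS]pairing_cat; last by rewrite !size_map !size_rev.
rewrite -!mulrA; congr (_ * _); rewrite /junction.
have [ij|ij] := eqVneq i j; have [kl|kl] := eqVneq k l.
- subst j l; rewrite /= !letters_covariance; case: eqVneq => [ik|]; last by rewrite !mul0r.
  by subst k; rewrite cheb2_sqr; ring.
- subst j; rewrite pairing_size; last by rewrite /= !size_map; lia.
  rewrite /= !letters_covariance; case: eqVneq => [ik|]; last by rewrite !mul0r.
  by subst k; rewrite (negbTE kl) mulr0.
- subst l; rewrite pairing_size; last by rewrite /= !size_map; lia.
  rewrite /= !letters_covariance; case: (eqVneq i k) => [ik|]; last by rewrite !mul0r.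
  by subst k; rewrite eq_sym (negbTE ij) mulr0.
- rewrite /= !letters_covariance; case: (eqVneq i k) => [ik|]; last by rewrite !mul0r.
  by rewrite mulr1.
Qed.

End free_words.

(** * Products of sums of letters *)

(** For two boxes, this is the integral of degree [size b + size b' + 2] of
    the tensor product of their indicators. Centring only the junction keeps
    the expression linear in each factor, unlike a definition by cases on
    whether the junction factors agree. *)
Definition wick (R : realType) (A : WstarProbSpace R) (T : Type) (f : T -> A)
    (b : seq T) (s t : T) (b' : seq T) : A :=
  (\prod_(k <- rev b) f k) * (f s * f t - expect A (f s * f t) *: 1) *
  (\prod_(k <- b') f k).

Section words.
Variable I : finType.
Implicit Types (b d : seq {set I}).

(** The index set for the expansion of a product of sums of letters. *)
Fixpoint words b : seq (seq I) :=
  if b is s :: b' then [seq i :: w | i <- enum s, w <- words b'] else [:: [::]].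

Lemma big_words_cons (V : nmodType) s b (F : seq I -> V) :
  \sum_(w <- words (s :: b)) F w = \sum_(i in s) \sum_(w <- words b) F (i :: w).
Proof. by rewrite /= big_allpairs_dep/= big_enum. Qed.

Lemma words_size b w : w \in words b -> size w = size b.
Proof.
elim: b w => [|s b IH] w /=; first by rewrite inE => /eqP->.
by move=> /allpairsP[[i w'] /= [_ /IH hw ->]] /=; rewrite hw.
Qed.

(** Disjointness of neighbouring sets is exactly what makes every choice of
    letters alternate. *)
Lemma words_neq_labels b w :
  sorted (fun s t : {set I} => [disjoint s & t]) b -> w \in words b ->
  sorted (@neq_labels I) w.
Proof.
elim: b w => [|s b IH] w; first by rewrite inE => _ /eqP->.
move=> sb /allpairsP[[i u] /= [+ ub ->]]; rewrite mem_enum => si.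
have su := IH _ (path_sorted sb) ub.
case: u ub su => // j u ub su; rewrite /= [path _ _ _]su andbT /neq_labels.
case: b sb ub {IH} => // t b /andP[dst _] /allpairsP[[k w'] /= [+ _ [jk _]]].
rewrite mem_enum -jk => tj; apply: contraTneq si => ->.
by rewrite (disjointFl dst tj).
Qed.

End words.

Section set_words.
Variables (R : realType) (A : WstarProbSpace R).
Local Notation C := R[i].
Local Notation phi := (expect A).
Variables (I : finType) (x : I -> A) (v : I -> R).
Hypothesis x_free : freely_independent (fun i => generated_algebra (x i)).
Hypothesis x_star : forall i, vn_star (x i) = x i.
Hypothesis x_mean : forall i, phi (x i) = 0.
Hypothesis x_var : forall i, phi (x i * x i) = (v i)%:C%C.
Hypothesis x_fourth : forall i, phi (x i * x i * (x i * x i)) = 2 * (v i)%:C%C ^+ 2.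

Implicit Types (b d : seq {set I}) (s t : {set I}).

(** An increment over a union of cells of a partition, as a sum of letters. *)
Definition block s : A := \sum_(i in s) x i.
Definition block_prod b : A := \prod_(s <- b) block s.
Definition disjoint_steps b := sorted (fun s t : {set I} => [disjoint s & t]) b.

Lemma block_prod_words b : block_prod b = \sum_(w <- words b) word_prod x w.
Proof.
elim: b => [|s b IH]; first by rewrite /block_prod big_seq1 /word_prod !big_nil.
rewrite /block_prod big_cons -/(block_prod b) IH big_words_cons mulr_suml.
apply: eq_bigr => i _; rewrite mulr_sumr; apply: eq_bigr => w _.
by rewrite word_prod_cons.
Qed.

Lemma block_prod_rev_words b : block_prod (rev b) = \sum_(w <- words b) word_prod x (rev w).
Proof.
elim: b => [|s b IH]; first by rewrite /block_prod big_seq1 /word_prod !big_nil.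
rewrite /block_prod rev_cons -cats1 big_cat big_seq1 -/(block_prod (rev b)) IH big_words_cons.
rewrite /= mulr_sumr; apply: eq_bigr => i _; rewrite mulr_suml; apply: eq_bigr => w _.
by rewrite word_prod_rev_cons.
Qed.

Definition wick_words (w w' : seq I) : A :=
  match w, w' with i :: b, j :: b' => labelled_prod (wick_list x v b i j b') | _, _ => 0 end.

Lemma wick_blocks b s t b' :
  wick block b s t b' =
  \sum_(w <- words (s :: b)) \sum_(w' <- words (t :: b')) wick_words w w'.
Proof.
rewrite big_words_cons.
rewrite /wick -/(block_prod (rev b)) -/(block_prod b') block_prod_rev_words block_prod_words.
have -> : block s * block t - phi (block s * block t) *: 1 =
    \sum_(i in s) \sum_(j in t) (x i * x j - phi (x i * x j) *: 1).
  rewrite /block big_distrlr /= linear_sum scaler_suml -sumrB.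
  apply: eq_bigr => i _.
  by rewrite linear_sum scaler_suml -sumrB.
rewrite [X in X * _]mulr_sumr mulr_suml; apply: eq_bigr => i _.
rewrite mulr_suml mulr_suml; apply: eq_bigr => w _.
rewrite big_words_cons [X in X * _]mulr_sumr mulr_suml; apply: eq_bigr => j _.
rewrite mulr_sumr; apply: eq_bigr => w' _.
by rewrite /= wick_listE.
Qed.

Lemma pairing_letters_cons i j w w' :
  pairing (letters x (i :: w)) (letters x (j :: w')) =
  phi (x i * x j) * pairing (letters x w) (letters x w').
Proof. rewrite [LHS]/= [in RHS](letters_covariance x_free x_mean x_var).
by case: eqVneq => [->|]; rewrite ?x_var ?mul0r. Qed.

(** The pairing is a product over positions, so its double sum over words
    factors into a product of covariances. *)
Lemma sum_pairing b d : size b = size d ->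
  \sum_(w <- words b) \sum_(w' <- words d) pairing (letters x w) (letters x w') =
  \prod_(p <- zip b d) phi (block p.1 * block p.2).
Proof.
elim: b d => [|s b IH] [|t d] // sz; first by rewrite !big_seq1 big_nil.
rewrite big_words_cons [zip _ _]/= big_cons -IH; last by case: sz.
have -> : phi (block s * block t) = \sum_(i in s) \sum_(j in t) phi (x i * x j).
  rewrite /block mulr_suml linear_sum; apply: eq_bigr => i _.
  by rewrite mulr_sumr linear_sum.
rewrite mulr_suml; apply: eq_bigr => i _; rewrite mulr_sumr.
apply: eq_bigr => w _.
rewrite big_words_cons mulr_suml; apply: eq_bigr => j _.
by rewrite mulr_sumr; apply: eq_bigr => w' _; rewrite pairing_letters_cons.
Qed.

Lemma block_prod_ip b d : size b = size d -> disjoint_steps b -> disjoint_steps d ->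
  ip (block_prod b) (block_prod d) = \prod_(p <- zip b d) phi (block p.1 * block p.2).
Proof.
move=> sz db dd; rewrite !block_prod_words ip_suml -sum_pairing//.
apply: eq_big_seq => w wb; rewrite ip_sumr; apply: eq_big_seq => w' wd.
have sw := words_neq_labels db wb; have sw' := words_neq_labels dd wd.
rewrite (words_ip x_free x_star x_mean sw' sw) !(pairing_letters x_free x_mean x_var).
by rewrite eq_sym; case: eqVneq => [->|]; rewrite ?mul0r.
Qed.

(** Both sides are multilinear in the block sums, which reduces the identity
    to words. *)
Lemma block_wick_ip b s t b' d k l d' :
  size b = size d -> size b' = size d' ->
  disjoint_steps (s :: b) -> disjoint_steps (t :: b') ->
  disjoint_steps (k :: d) -> disjoint_steps (l :: d') ->
  ip (block_prod (rev (k :: d)) * block_prod (l :: d')) (wick block b s t b') =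
  ip (block_prod (rev (k :: d))) (block_prod (rev (s :: b))) *
  ip (block_prod (l :: d')) (block_prod (t :: b')).
Proof.
move=> sz sz' sb sb' sd sd'; rewrite wick_blocks.
rewrite [block_prod (rev (k :: d))]block_prod_rev_words.
rewrite [block_prod (rev (s :: b))]block_prod_rev_words.
rewrite [block_prod (l :: d')]block_prod_words [block_prod (t :: b')]block_prod_words.
rewrite mulr_suml !ip_suml mulr_suml; apply: eq_big_seq => w wd.
rewrite mulr_sumr ip_suml mulr_sumr; apply: eq_big_seq => w' wd'.
rewrite !ip_sumr mulr_suml; apply: eq_big_seq => u ub.
rewrite ip_sumr mulr_sumr; apply: eq_big_seq => u' ub'.
have [su su'] := (words_neq_labels sb ub, words_neq_labels sb' ub').
have [sw sw'] := (words_neq_labels sd wd, words_neq_labels sd' wd').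
move: (words_size ub) (words_size ub') (words_size wd) (words_size wd').
case: u su {ub} => // i u su; case: u' su' {ub'} => // j u' su'.
case: w sw {wd} => // i' w sw; case: w' sw' {wd'} => // j' w' sw' [s1] [s2] [s3] [s4].
by rewrite (wick_words_ip (v := v))// ?s1 ?s2 ?s3 ?s4.
Qed.

Lemma block_wick_low b s t b' d d' :
  (size d + size d' <= size b + size b')%N ->
  disjoint_steps (s :: b) -> disjoint_steps (t :: b') ->
  disjoint_steps d -> disjoint_steps d' ->
  ip (block_prod (rev d) * block_prod d') (wick block b s t b') = 0.
Proof.
move=> sz sb sb' sd sd'; rewrite wick_blocks block_prod_rev_words block_prod_words.
rewrite mulr_suml ip_suml big_seq big1// => w wd.
rewrite mulr_sumr ip_suml big_seq big1// => w' wd'.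
rewrite ip_sumr big_seq big1// => u ub.
rewrite ip_sumr big_seq big1// => u' ub'.
have [su su'] := (words_neq_labels sb ub, words_neq_labels sb' ub').
have [sw sw'] := (words_neq_labels sd wd, words_neq_labels sd' wd').
move: (words_size ub) (words_size ub') (words_size wd) (words_size wd').
case: u su {ub} => // i u su; case: u' su' {ub'} => // j u' su' [s1] [s2] s3 s4.
rewrite /ip labelled_prod_star; last exact: wick_list_self_adjoint.
rewrite (low_degree_orthogonal (v := v))//.
- exact: wick_list_alternating.
- exact: wick_list_centred.
- by rewrite wick_list_size s1 s2 s3 s4; case: (i != j); lia.
Qed.

End set_words.

(** * Increments of a free Brownian motion *)

Section partition.
Variable R : realType.

(** The subdivision points are the sorted values of [L] and zero, which
    provides a first point when [L] is empty. *)
Lemma common_partition (L : seq R) : (forall z, z \in L -> 0 <= z) ->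
  exists (r : nat) (t : nat -> R), [/\ 0 <= t 0%N,
    forall i, (i < r)%N -> t i < t i.+1 &
    forall z, z \in L -> exists2 i, (i <= r)%N & t i = z].
Proof.
move=> L0; pose s := sort <=%O (undup (0 :: L)).
have s_mem z : (z \in s) = (z \in 0 :: L) by rewrite mem_sort mem_undup.
have s_gt0 : (0 < size s)%N.
  by have : 0 \in s by [rewrite s_mem mem_head]; case: (s).
have ss : sorted <%O s by rewrite sort_lt_sorted undup_uniq.
exists (size s).-1, (nth 0 s); split.
- have : nth 0 s 0%N \in s by apply: mem_nth.
  by rewrite s_mem inE => /orP[/eqP->//|/L0].
- move=> i ir; apply: (sorted_ltn_nth lt_trans 0 ss) => //; rewrite inE; lia.
- move=> z zL; exists (index z s).
    have : (index z s < size s)%N by rewrite index_mem s_mem inE zL orbT.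
    lia.
  by rewrite nth_index// s_mem inE zL orbT.
Qed.

(** Disjointness of closed intervals. *)
Definition apart (J K : R * R) := (J.2 < K.1) || (K.2 < J.1).

Lemma apart_sym : symmetric apart.
Proof. by move=> J K; rewrite /apart orbC. Qed.

Definition valid_itvs (b : seq (R * R)) := forall J, J \in b -> 0 <= J.1 < J.2.

End partition.

Lemma zip_map2 (T U : Type) (f : T -> U) b d :
  zip (map f b) (map f d) = map (fun p => (f p.1, f p.2)) (zip b d).
Proof. by elim: b d => [|J b IH] [|K d] //=; rewrite IH. Qed.

Lemma zip_mem (T U : eqType) (b : seq T) (d : seq U) p :
  p \in zip b d -> p.1 \in b /\ p.2 \in d.
Proof.
elim: b d => [|J b IH] [|K d] //=; rewrite !inE => /predU1P[->|/IH[-> ->]] /=.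
  by rewrite !eqxx.
by rewrite !orbT.
Qed.

Section increments.
Variables (R : realType) (A : WstarProbSpace R) (S : R -> A).
Hypothesis S_bm : free_brownian_motion S.
Local Notation phi := (expect A).

Definition incr (J : R * R) : A := S J.2 - S J.1.

Lemma incr_star J : 0 <= J.1 < J.2 -> vn_star (incr J) = incr J.
Proof.
have [_ st _ _] := S_bm => /andP[J0 J1]; rewrite /incr starB !st//.
by rewrite (le_trans J0)// ltW.
Qed.

Lemma incr_moments J : 0 <= J.1 < J.2 ->
  [/\ phi (incr J) = 0, phi (incr J * incr J) = (J.2 - J.1)%:C%C
    & phi (incr J * incr J * (incr J * incr J)) = 2 * (J.2 - J.1)%:C%C ^+ 2].
Proof.
have [_ _ law _] := S_bm => /andP[J0 J1].
by apply: semicircular_moments; [rewrite subr_gt0|exact: law].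
Qed.

(** Over a partition containing all the endpoints in [L], every increment over
    an interval of [L] is a sum of increments over cells, and these are the
    letters to which freeness applies. *)
Lemma incr_free_system (L : seq (R * R)) : valid_itvs L ->
  exists (r : nat) (x : 'I_r -> A) (v : 'I_r -> R) (sets : R * R -> {set 'I_r}),
  [/\ freely_independent (fun i => generated_algebra (x i)),
      forall i, vn_star (x i) = x i,
      forall i, [/\ phi (x i) = 0, phi (x i * x i) = (v i)%:C%C
        & phi (x i * x i * (x i * x i)) = 2 * (v i)%:C%C ^+ 2],
      forall J, J \in L -> incr J = block x (sets J) &
      forall J K, apart J K -> [disjoint sets J & sets K]].
Proof.
move=> pL.
have [|r [t [t0 tS tL]]] := @common_partition R (map fst L ++ map snd L).
  move=> z; rewrite mem_cat => /orP[]/mapP[J /pL/andP[J0 J1] ->] //.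
  by rewrite (le_trans J0)// ltW.
have tlt i j : (i < j <= r)%N -> t i < t j.
  move=> /andP[]; elim: j => // j IH; rewrite ltnS leq_eqVlt => /predU1P[-> jr|ij jr].
    exact: tS.
  by apply: (lt_trans (IH ij (ltnW jr))); exact: tS.
have tge0 i : (i <= r)%N -> 0 <= t i.
  by case: i => // i ir; rewrite (le_trans t0)// ltW// tlt.
pose x (i : 'I_r) := incr (t i, t i.+1).
pose v (i : 'I_r) := t i.+1 - t i.
pose sets (J : R * R) := [set l : 'I_r | J.1 <= t l < J.2]%SET.
have step (i : 'I_r) : 0 <= (t i, t i.+1).1 < (t i, t i.+1).2.
  by rewrite /= tge0 ?tS// ltnW.
exists r, x, v, sets; split.
- by have [_ _ _ fr] := S_bm; exact: fr.
- by move=> i; rewrite incr_star.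
- by move=> i; exact: incr_moments (step i).
- move=> J JL.
  have [i ir Ji] : exists2 i, (i <= r)%N & t i = J.1.
    by apply: tL; rewrite mem_cat map_f.
  have [j jr Jj] : exists2 i, (i <= r)%N & t i = J.2.
    by apply: tL; rewrite mem_cat [X in _ || X]map_f ?orbT.
  have ij : (i <= j)%N.
    rewrite leqNgt; apply/negP => ji.
    have := tlt j i; rewrite ji ir Ji Jj => /(_ isT).
    by have /andP[_ /lt_trans h] := pL _ JL => /h; rewrite ltxx.
  have tle a b : (a <= r)%N -> (b <= r)%N -> (t a < t b) = (a < b)%N.
    move=> ar br; have [ab|ba] := ltnP a b; first by rewrite tlt ?ab.
    apply/negbTE; rewrite -leNgt; move: ba; rewrite leq_eqVlt => /predU1P[->//|ba].
    by rewrite ltW// tlt ?ba.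
  rewrite /incr -Jj -Ji -(telescope_sumr (fun k => S (t k)) ij) /block.
  under [RHS]eq_bigl => l.
    have lr := ltn_ord l.
    rewrite inE -Ji -Jj leNgt !tle ?(ltnW lr)// -leqNgt; over.
  rewrite -(big_mkord (fun l => i <= l < j)%N (fun l => S (t l.+1) - S (t l))).
  rewrite (big_nat_widen _ _ _ _ _ jr) (big_nat_widenl _ _ _ _ _ (leq0n i)).
  by apply: eq_bigl => l; lia.
- move=> J K JK; apply/pred0P => l /=; rewrite !inE; apply/negbTE/negP.
  move: JK; rewrite /apart => JK /andP[/andP[h1 h2] /andP[h3 h4]].
  by case/orP: JK; lra.
Qed.

Definition bprod (b : seq (R * R)) : A := \prod_(J <- b) incr J.
Definition apart_steps := sorted (@apart R).

Lemma bprod_blocks (I : finType) (x : I -> A) (f : R * R -> {set I}) b :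
  (forall J, J \in b -> incr J = block x (f J)) -> bprod b = block_prod x (map f b).
Proof. by move=> h; rewrite /bprod /block_prod big_map; apply: eq_big_seq. Qed.

Lemma apart_disjoint_steps (I : finType) (f : R * R -> {set I}) b :
  (forall J K, apart J K -> [disjoint f J & f K]) -> apart_steps b ->
  disjoint_steps (map f b).
Proof.
move=> h; rewrite /disjoint_steps sorted_map.
by apply: sub_sorted => J K /h.
Qed.

Lemma wick_incr_blocks (I : finType) (x : I -> A) (f : R * R -> {set I}) b J K b' :
  (forall J', J' \in J :: K :: b ++ b' -> incr J' = block x (f J')) ->
  wick incr b J K b' = wick (block x) (map f b) (f J) (f K) (map f b').
Proof.
move=> h; rewrite /wick -map_rev !big_map; congr (_ * _ * _).
- apply: eq_big_seq => L; rewrite mem_rev => Lb; apply: h.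
  by rewrite !inE mem_cat Lb !orbT.
- by rewrite !h// !inE eqxx ?orbT.
- apply: eq_big_seq => L Lb; apply: h.
  by rewrite !inE mem_cat Lb !orbT.
Qed.

Lemma bprod_ip b d : size b = size d -> valid_itvs b -> valid_itvs d ->
  apart_steps b -> apart_steps d ->
  ip (bprod b) (bprod d) = \prod_(p <- zip b d) phi (incr p.1 * incr p.2).
Proof.
move=> sz pb pd ab ad.
have [|r [x [v [f [xf xs xm xI fd]]]]] := @incr_free_system (b ++ d).
  by move=> J; rewrite mem_cat => /orP[/pb|/pd].
have hb J : J \in b -> incr J = block x (f J).
  by move=> Jb; apply: xI; rewrite mem_cat Jb.
have hd J : J \in d -> incr J = block x (f J).
  by move=> Jb; apply: xI; rewrite mem_cat Jb orbT.
rewrite (bprod_blocks hb) (bprod_blocks hd) (block_prod_ip xf xs (v := v)).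
- rewrite zip_map2 big_map; apply: eq_big_seq => -[J K] /= JK.
  by have /= [Jb Kd] := zip_mem JK; rewrite hb ?hd.
- by move=> i; have [] := xm i.
- by move=> i; have [] := xm i.
- by rewrite !size_map.
- exact: apart_disjoint_steps.
- exact: apart_disjoint_steps.
Qed.

Lemma bprod_wick_ip b J K b' d P Q d' : size b = size d -> size b' = size d' ->
  valid_itvs (J :: b) -> valid_itvs (K :: b') -> valid_itvs (P :: d) -> valid_itvs (Q :: d') ->
  apart_steps (J :: b) -> apart_steps (K :: b') ->
  apart_steps (P :: d) -> apart_steps (Q :: d') ->
  ip (bprod (rev (P :: d)) * bprod (Q :: d')) (wick incr b J K b') =
  ip (bprod (rev (P :: d))) (bprod (rev (J :: b))) *
  ip (bprod (Q :: d')) (bprod (K :: b')).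
Proof.
move=> sz sz' p1 p2 p3 p4 a1 a2 a3 a4.
have [|r [x [v [f [xf xs xm xI fd]]]]] :=
    @incr_free_system ((J :: b) ++ (K :: b') ++ (P :: d) ++ (Q :: d')).
  by move=> L; rewrite !mem_cat => /or4P[/p1|/p2|/p3|/p4].
rewrite (wick_incr_blocks (x := x) (f := f)); last first.
  move=> L; rewrite !(inE, mem_cat) => LL; apply: xI; rewrite !(inE, mem_cat).
  by case/or4P: LL => ->; rewrite ?orbT.
rewrite !(bprod_blocks (x := x) (f := f)); try by
  move=> L; rewrite ?mem_rev => LL; apply: xI; rewrite !mem_cat LL ?orbT.
rewrite !map_rev !map_cons (block_wick_ip xf xs (v := v)) ?size_map//.
- by move=> i; have [] := xm i.
- by move=> i; have [] := xm i.
- by move=> i; have [] := xm i.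
- exact: (apart_disjoint_steps fd a1).
- exact: (apart_disjoint_steps fd a2).
- exact: (apart_disjoint_steps fd a3).
- exact: (apart_disjoint_steps fd a4).
Qed.

Lemma bprod_wick_low b J K b' d d' : (size d + size d' <= size b + size b')%N ->
  valid_itvs (J :: b) -> valid_itvs (K :: b') -> valid_itvs d -> valid_itvs d' ->
  apart_steps (J :: b) -> apart_steps (K :: b') ->
  apart_steps d -> apart_steps d' ->
  ip (bprod (rev d) * bprod d') (wick incr b J K b') = 0.
Proof.
move=> sz p1 p2 p3 p4 a1 a2 a3 a4.
have [|r [x [v [f [xf xs xm xI fd]]]]] :=
    @incr_free_system ((J :: b) ++ (K :: b') ++ d ++ d').
  by move=> L; rewrite !mem_cat => /or4P[/p1|/p2|/p3|/p4].
rewrite (wick_incr_blocks (x := x) (f := f)); last first.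
  move=> L; rewrite !(inE, mem_cat) => LL; apply: xI; rewrite !(inE, mem_cat).
  by case/or4P: LL => ->; rewrite ?orbT.
rewrite !(bprod_blocks (x := x) (f := f)); try by
  move=> L; rewrite ?mem_rev => LL; apply: xI; rewrite !mem_cat LL ?orbT.
rewrite !map_rev (block_wick_low xf xs (v := v)) ?size_map//.
- by move=> i; have [] := xm i.
- by move=> i; have [] := xm i.
- exact: (apart_disjoint_steps fd a1).
- exact: (apart_disjoint_steps fd a2).
- exact: (apart_disjoint_steps fd a3).
- exact: (apart_disjoint_steps fd a4).
Qed.

End increments.

(** * Wick products of combinations of boxes *)

Section wick_products.
Variables (R : realType) (A : WstarProbSpace R) (S : R -> A).
Hypothesis S_bm : free_brownian_motion S.
Local Notation phi := (expect A).
Local Notation C := R[i].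
Local Notation itvs := (seq (R * R)).
Implicit Types (b d : itvs) (c : seq (C * itvs)).

(** The properties of a box, as a list of intervals, that make all the words
    of its refinement alternate: consecutive intervals are disjoint. *)
Definition admissible m b := [/\ valid_itvs b, apart_steps b & size b = m].

Lemma admissible_rev m b : admissible m b -> admissible m (rev b).
Proof.
move=> [v a s]; split; rewrite ?size_rev//.
  by move=> J; rewrite mem_rev; exact: v.
by rewrite /apart_steps rev_sorted (eq_sorted (e' := @apart R))// => x y; exact: apart_sym.
Qed.

Lemma admissible_behead m b : admissible m.+1 b -> admissible m (behead b).
Proof.
case: b => [[]//|J b] [v a [s]]; split => //; last exact: path_sorted a.
by move=> K Kb; apply: v; rewrite inE Kb orbT.
Qed.

(** The default value of [head] is never reached on boxes of positive length.
    *)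
Definition wick_bprod b d : A :=
  wick (incr S) (behead (rev b)) (head (0, 0) (rev b)) (head (0, 0) d) (behead d).

Lemma rev_split m b : admissible m.+1 b ->
  exists J b', [/\ b = rev (J :: b'), rev b = J :: b' & admissible m.+1 (J :: b')].
Proof.
move=> /admissible_rev; case e : (rev b) => [|J b'] g; first by case: g.
by exists J, b'; split => //; rewrite -e revK.
Qed.

Lemma wick_bprod_ip m p b b' d d' :
  admissible m.+1 b -> admissible p.+1 b' -> admissible m.+1 d -> admissible p.+1 d' ->
  ip (bprod S d * bprod S d') (wick_bprod b b') =
  ip (bprod S d) (bprod S b) * ip (bprod S d') (bprod S b').
Proof.
move=> /rev_split[J [b1 [-> eb gb]]] gb' /rev_split[K [d1 [-> ed gd]]] gd'.
rewrite /wick_bprod eb /=; case: b' gb' => [[]//|J' b'] gb'; case: d' gd' => [[]//|K' d'] gd'.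
case: gb gb' gd gd' => v1 a1 [s1] [v2 a2 [s2]] [v3 a3 [s3]] [v4 a4 [s4]].
by rewrite (bprod_wick_ip S_bm)// ?s1 ?s2 ?s3 ?s4.
Qed.

Lemma wick_bprod_low m p q r b b' d d' :
  admissible m b -> admissible p b' -> admissible q d -> admissible r d' ->
  (0 < m)%N -> (0 < p)%N ->
  (q + r + 2 <= m + p)%N ->
  ip (bprod S d * bprod S d') (wick_bprod b b') = 0.
Proof.
case: m => // m; case: p => // p.
move=> /rev_split[J [b1 [-> eb gb]]] gb' gd gd' _ _ mp.
rewrite /wick_bprod eb /=; case: b' gb' => [[]//|J' b'] gb'.
have {}gd := admissible_rev gd.
case: gb gb' gd gd' => v1 a1 [s1] [v2 a2 [s2]] [v3 a3 s3] [v4 a4 s4].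
rewrite -(revK d) (bprod_wick_low S_bm)// s1 s2 s3 s4; lia.
Qed.

(** Removing the centring at the junction costs a multiple of a product with
    two factors less. *)
Lemma wick_bprodE m p b d : admissible m.+1 b -> admissible p.+1 d ->
  exists b' d' k, [/\ admissible m b', admissible p d' &
    wick_bprod b d = bprod S b * bprod S d - k *: (bprod S b' * bprod S d')].
Proof.
move=> /rev_split[J [b1 [-> eb gb]]]; case: d => [[]//|K d] gd.
exists (rev b1), d, (phi (incr S J * incr S K)); split.
- exact/admissible_rev/(admissible_behead gb).
- exact: admissible_behead gd.
rewrite /wick_bprod eb /wick /= /bprod rev_cons -cats1 big_cat big_seq1 big_cons /=.
by rewrite mulrBr mulrBl -scalerAr mulr1 -scalerAl !mulrA.
Qed.

(** Of the two terms of a Wick product, the contracted one is of lower degree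
    and pairs to zero with the other Wick product. *)
Lemma wick_bprod_bprod_ip m p b b' d d' :
  admissible m.+1 b -> admissible p.+1 b' -> admissible m.+1 d -> admissible p.+1 d' ->
  ip (wick_bprod d d') (wick_bprod b b') =
  ip (bprod S d) (bprod S b) * ip (bprod S d') (bprod S b').
Proof.
move=> gb gb' gd gd'.
have [d1 [d2 [k [g1 g2 ->]]]] := wick_bprodE gd gd'.
rewrite ipBl ipZl (wick_bprod_ip gb gb' gd gd') (wick_bprod_low gb gb' g1 g2)//; last lia.
by rewrite mulr0 subr0.
Qed.

Definition admissible_comb m c := forall p, p \in c -> admissible m p.2.
(** Step integrals with boxes as lists, so that different numbers of factors
    can be mixed. *)
Definition combination c : A := \sum_(p <- c) p.1 *: bprod S p.2.
Definition wick_comb c (c' : seq (C * itvs)) : A :=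
  \sum_(p <- c) \sum_(q <- c') (p.1 * q.1) *: wick_bprod p.2 q.2.

Lemma wick_comb_low m p q r (c c' : seq (C * itvs)) d d' :
  admissible_comb m c -> admissible_comb p c' -> admissible q d ->
  admissible r d' -> (0 < m)%N -> (0 < p)%N ->
  (q + r + 2 <= m + p)%N ->
  ip (bprod S d * bprod S d') (wick_comb c c') = 0.
Proof.
move=> gc gc' gd gd' m0 p0 mp; rewrite /wick_comb ip_sumr big_seq big1// => x /gc gx.
rewrite ip_sumr big_seq big1// => y /gc' gy.
by rewrite ipZr (wick_bprod_low gx gy gd gd')// mulr0.
Qed.

Lemma wick_comb_ip m p (c c' : seq (C * itvs)) d d' :
  admissible_comb m.+1 c -> admissible_comb p.+1 c' -> admissible m.+1 d -> admissible p.+1 d' ->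
  ip (bprod S d * bprod S d') (wick_comb c c') =
  ip (bprod S d) (combination c) * ip (bprod S d') (combination c').
Proof.
move=> gc gc' gd gd'; rewrite /wick_comb /combination !ip_sumr mulr_suml.
apply: eq_big_seq => x /gc gx; rewrite ip_sumr mulr_sumr.
apply: eq_big_seq => y /gc' gy.
by rewrite !ipZr (wick_bprod_ip gx gy gd gd') conjM mulrACA.
Qed.

Lemma wick_bprod_comb_ip m p (c c' : seq (C * itvs)) d d' :
  admissible_comb m.+1 c -> admissible_comb p.+1 c' -> admissible m.+1 d -> admissible p.+1 d' ->
  ip (wick_bprod d d') (wick_comb c c') =
  ip (bprod S d) (combination c) * ip (bprod S d') (combination c').
Proof.
move=> gc gc' gd gd'; rewrite /wick_comb /combination !ip_sumr mulr_suml.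
apply: eq_big_seq => x /gc gx; rewrite ip_sumr mulr_sumr.
apply: eq_big_seq => y /gc' gy.
by rewrite !ipZr (wick_bprod_bprod_ip gx gy gd gd') conjM mulrACA.
Qed.

(** The isometry for the tensor product of two step functions. *)
Lemma nrm2_wick_comb m p (c c' : seq (C * itvs)) :
  admissible_comb m.+1 c -> admissible_comb p.+1 c' ->
  nrm2 (wick_comb c c') = nrm2 (combination c) * nrm2 (combination c').
Proof.
move=> gc gc'; apply: complexI; rewrite rmorphM /= -!ip_nrm2.
rewrite {1}/wick_comb ip_suml {1}/combination ip_suml mulr_suml.
apply: eq_big_seq => x /gc gx; rewrite ip_suml {2}/combination ip_suml mulr_sumr.
apply: eq_big_seq => y /gc' gy.
by rewrite !ipZl (wick_bprod_comb_ip gc gc' gx gy) mulrACA.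
Qed.

End wick_products.

(** * Rectangles and reversal for Lebesgue measure *)

Local Open Scope classical_set_scope.
Local Open Scope ring_scope.

Section lebesgueN_rectangles.
Variable R : realType.
Local Notation E := (measurableTypeR R).
Implicit Types (n : nat) (B : nat -> set E).

(** The sides are indexed by all natural numbers, so that removing the first
    coordinate is a mere shift of [B]. *)
Definition rect n B : set (n.-tuple E) := [set t | forall i : 'I_n, B i (tnth t i)].
Arguments rect : clear implicits.

Lemma measurable_rect n B : (forall i, measurable (B i)) -> measurable (rect n B).
Proof.
move=> mB; have -> : rect n B = \bigcap_(i in [set: 'I_n]) ((@tnth n E)^~ i @^-1` B i).
  by apply/seteqP; split => [t Bt i _|t Bt i]; [exact: Bt|exact: (Bt i)].
apply: fin_bigcap_measurable => // i _.
by rewrite -[X in measurable X]setTI; exact: measurable_tnth.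
Qed.

Lemma lebesgueN_rect n B : (forall i, measurable (B i)) ->
  lebesgueN R n (rect n B) = (\prod_(i < n) lebesgue_measure (B i))%E.
Proof.
elim: n B => [|n IH] B mB.
  by rewrite big_ord0 /= diracE mem_set//; move=> -[].
rewrite big_ord_recl [LHS]/= /cons_measure /pushforward.
have -> : @cons_pair _ E n @^-1` rect n.+1 B = B 0%N `*` rect n (fun i => B i.+1).
  apply/seteqP; split => -[x t] /=.
    move=> Bt; split; first by have := Bt ord0; rewrite tnth0.
    by move=> i; have := Bt (lift ord0 i); rewrite tnthS.
  move=> [Bx Bt] i; case: (unliftP ord0 i) => [j ->|->]; last by rewrite tnth0.
  by rewrite tnthS; exact: Bt.
by rewrite product_measure1E// ?IH//; exact: measurable_rect.
Qed.

Definition tuple_rev n (t : n.-tuple E) : n.-tuple E := [tuple of rev t].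

Lemma tnth_tuple_rev n (t : n.-tuple E) i : tnth (tuple_rev t) i = tnth t (rev_ord i).
Proof.
by rewrite !(tnth_nth (0 : R)) /= nth_rev ?size_tuple.
Qed.

Lemma tuple_revK n : involutive (@tuple_rev n).
Proof. by move=> t; apply: val_inj; rewrite /= revK. Qed.

Lemma measurable_tuple_rev n : measurable_fun setT (@tuple_rev n).
Proof.
apply/measurable_fun_tnthP => i.
have -> : @tnth n E ^~ i \o @tuple_rev n = @tnth n E ^~ (rev_ord i).
  by apply/funext => t /=; rewrite tnth_tuple_rev.
exact: measurable_tnth.
Qed.

Lemma tuple_rev_rect n B :
  @tuple_rev n @^-1` rect n B = rect n (fun i => B (n - i.+1)%N).
Proof.
apply/seteqP; split => t Bt i.
  by have := Bt (rev_ord i); rewrite tnth_tuple_rev rev_ordK.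
rewrite tnth_tuple_rev; have := Bt (rev_ord i) => /=.
by rewrite subnSK// subKn// ltnW.
Qed.

(** Rectangles are stable under intersection and generate the sigma-algebra,
    and reversal permutes the sides of a rectangle without changing its
    volume. *)
Lemma lebesgueN_rev n (D : set (n.-tuple E)) : measurable D ->
  pushforward (lebesgueN R n) (@tuple_rev n) D = lebesgueN R n D.
Proof.
pose G := [set U : set (n.-tuple E) | exists B,
  (forall i, measurable (B i)) /\ U = rect n B].
pose g (k : nat) := rect n (fun=> `[- (k%:R : R), k%:R]%classic).
move=> mD; have := measurable_tuple_rev; move=> mrev.
pose m1 := pushforward (lebesgueN R n) (@tuple_rev n).
apply: (measure_unique G g _ _ _ _ (m1 : {measure set _ -> \bar R})) => //.
- apply/seteqP; split.
    apply: smallest_sub; first exact: smallest_sigma_algebra.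
    move=> U; rewrite -bigcup_seq => -[i _ [V mV <-]].
    apply: sub_sigma_algebra; exists (fun j => if j == i :> nat then V else setT).
    split; first by move=> j; case: ifP.
    rewrite setTI; apply/seteqP; split => t /=.
      by move=> Vt j; case: eqVneq => // /val_inj ->.
    by move=> /(_ i); rewrite eqxx.
  apply: smallest_sub; first exact: sigma_algebra_measurable.
  by move=> _ [B [mB ->]]; exact: measurable_rect.
- move=> _ _ [B [mB ->]] [B' [mB' ->]]; exists (fun i => B i `&` B' i); split.
    by move=> i; exact: measurableI.
  apply/seteqP; split => t /=; first by move=> [h h'] i; split.
  by move=> h; split => i; have [] := h i.
- by move=> k; exists (fun=> `[- (k%:R : R), k%:R]%classic).
- rewrite -subTset => t _.
  pose M := \sum_(i < n) `|tnth t i : R|.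
  exists (Num.truncn M).+1 => // i /=; rewrite in_itv /= -ler_norml.
  apply: (@le_trans _ _ M); last by rewrite ltW// truncnS_gt.
  by rewrite /M (bigD1 i)//= lerDl sumr_ge0.
- exact: mrev.
- move=> ? _ [B [mB ->]]; transitivity (lebesgueN R n (@tuple_rev n @^-1` rect n B)) => //.
  rewrite tuple_rev_rect !lebesgueN_rect//.
  rewrite (reindex_inj rev_ord_inj) /= [RHS]lebesgueN_rect//.
  by apply: eq_bigr => i _; rewrite subnSK// subKn// ltnW.
- move=> ? k; change (lebesgueN R n (@tuple_rev n @^-1` g k) < +oo)%E.
  rewrite /g tuple_rev_rect lebesgueN_rect//.
  set P := (\prod_(_ < n) _)%E; suff /andP[] : (0 <= P < +oo)%E by [].
  apply: (@big_ind _ (fun x : \bar R => (0 <= x < +oo)%E)).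
  + by rewrite lee_fin ler01 ltry.
  + move=> x y /andP[x0 xy] /andP[y0 yy]; rewrite mule_ge0//=.
    by rewrite lte_mul_pinfty// ge0_fin_numE.
  + by move=> i _; rewrite measure_ge0/= lebesgue_measure_itv; case: ifP; rewrite ltry.
Qed.

End lebesgueN_rectangles.
Arguments rect {R} n B _.

(** * Square norms on the orthant *)

Section square_norm.
Variables (R : realType) (n : nat).
Local Notation E := (measurableTypeR R).
Local Notation C := R[i].
Implicit Types f g : n.-tuple E -> C.

Definition cmeasurable f :=
  measurable_fun (orthant R n) (fun t => complex.Re (f t)) /\
  measurable_fun (orthant R n) (fun t => complex.Im (f t)).

Lemma orthantE : orthant R n = rect n (fun=> `[(0 : R), +oo[%classic).
Proof.
apply/seteqP; split => t h i; first by rewrite /= in_itv/= h.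
by have := h i; rewrite /= in_itv/= andbT.
Qed.

Lemma measurable_orthant : measurable (orthant R n).
Proof. by rewrite orthantE; apply: measurable_rect => i; exact: measurable_itv. Qed.

Lemma orthant_rev t : orthant R n t -> orthant R n (tuple_rev t).
Proof. by move=> h i; rewrite tnth_tuple_rev; exact: h. Qed.

Lemma cmeasurable_sqr f : cmeasurable f ->
  measurable_fun (orthant R n) (fun t => (sqr_modulus (f t))%:E).
Proof.
move=> [mr mi]; apply/measurable_EFinP.
by apply: measurable_funD; apply: measurable_funX.
Qed.

Lemma cmeasurableB f g : cmeasurable f -> cmeasurable g ->
  cmeasurable (fun t => f t - g t).
Proof.
move=> [fr fi] [gr gi]; split.
  rewrite (_ : (fun _ => _) = (fun t => complex.Re (f t) - complex.Re (g t))).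
    exact: measurable_funB.
  by apply/funext => t; case: (f t) (g t) => ? ? [? ?].
rewrite (_ : (fun _ => _) = (fun t => complex.Im (f t) - complex.Im (g t))).
  exact: measurable_funB.
by apply/funext => t; case: (f t) (g t) => ? ? [? ?].
Qed.

Lemma sqr_norm_ge0 f : (0 <= sqr_norm f)%E.
Proof. by apply: integral_ge0 => t _; rewrite lee_fin sqr_modulus_ge0. Qed.

(** The pointwise inequality [`|a - b| ^+ 2 <= 2 * `|a| ^+ 2 + 2 * `|b| ^+ 2],
    integrated over the orthant. *)
Lemma sqr_normB_le f g h : cmeasurable f -> cmeasurable g -> cmeasurable h ->
  (forall t, orthant R n t -> f t = g t - h t) ->
  (sqr_norm f <= 2%:E * sqr_norm g + 2%:E * sqr_norm h)%E.
Proof.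
move=> mf mg mh fgh; rewrite /sqr_norm.
have mO := measurable_orthant.
have [[mf2 mg2] mh2] := (cmeasurable_sqr mf, cmeasurable_sqr mg, cmeasurable_sqr mh).
have ge0 k t : (0 <= (sqr_modulus (k t : C))%:E)%E by rewrite lee_fin sqr_modulus_ge0.
have m2 k : measurable_fun (orthant R n) (fun t => (sqr_modulus (k t : C))%:E) ->
    measurable_fun (orthant R n) (fun t => 2%:E * (sqr_modulus (k t : C))%:E)%E.
  by move=> mk; apply: emeasurable_funM => //; exact: measurable_cst.
have Z k : measurable_fun (orthant R n) (fun t => (sqr_modulus (k t : C))%:E) ->
    (2%:E * \int[lebesgueN R n]_(t in orthant R n) (sqr_modulus (k t))%:E =
    \int[lebesgueN R n]_(t in orthant R n) (2%:E * (sqr_modulus (k t))%:E))%E.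
  by move=> mk; rewrite ge0_integralZl// lee_fin.
rewrite !Z// -ge0_integralD//; first last.
- exact: m2.
- by move=> t _; rewrite mule_ge0.
- exact: m2.
- by move=> t _; rewrite mule_ge0.
apply: ge0_le_integral => //.
- by apply: emeasurable_funD; exact: m2.
- move=> t Ot; rewrite fgh// -!EFinM -EFinD lee_fin.
  case: (g t) (h t) => [a b] [c d]; rewrite /sqr_modulus /=.
  by have := sqr_ge0 (a + c); have := sqr_ge0 (b + d); lra.
Qed.

(** The operation on functions that corresponds to the adjoint of the
    integral. *)
Definition mirror f t : C := (f (tuple_rev t))^*.

Lemma cmeasurable_mirror f : cmeasurable f -> cmeasurable (mirror f).
Proof.
have h (u : n.-tuple E -> R) : measurable_fun (orthant R n) u ->
    measurable_fun (orthant R n) (u \o @tuple_rev R n).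
  move=> mu; apply: (measurable_comp measurable_orthant _ mu).
    by move=> _ [t Ot <-]; exact: orthant_rev.
  by apply: measurable_funTS; exact: measurable_tuple_rev.
move=> [mr mi]; split.
  rewrite (_ : (fun t => complex.Re (mirror f t)) = (fun t => complex.Re (f t)) \o @tuple_rev R n).
    exact: h.
  apply/funext => t. rewrite /= /mirror. case: (f _) => a b. by [].
rewrite (_ : (fun t => complex.Im (mirror f t)) =
    \- ((fun t => complex.Im (f t)) \o @tuple_rev R n)).
  by apply: measurableT_comp => //; exact: h.
by apply/funext => t; rewrite /= /mirror; case: (f _).
Qed.

Lemma sqr_norm_mirror f : cmeasurable f -> sqr_norm (mirror f) = sqr_norm f.
Proof.
move=> mf; rewrite /sqr_norm; have mO := measurable_orthant.
have mrev := @measurable_tuple_rev R n.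
transitivity (\int[pushforward (lebesgueN R n) (@tuple_rev R n)]_(t in orthant R n)
    (sqr_modulus (f t))%:E)%E.
  rewrite ge0_integral_pushforward//; last 2 first.
  - exact: cmeasurable_sqr.
  - by move=> t _; rewrite lee_fin sqr_modulus_ge0.
  have -> : @tuple_rev R n @^-1` orthant R n = orthant R n.
    apply/seteqP; split => t; last exact: orthant_rev.
    by move=> /orthant_rev; rewrite tuple_revK.
  by apply: eq_integral => t _; rewrite [LHS]/= /mirror sqr_modulus_conj.
apply: eq_measure_integral => D mD _; exact: lebesgueN_rev.
Qed.

End square_norm.

(** * The isometry on step functions *)

Section overlap.
Variable R : realType.
Local Notation E := (measurableTypeR R).

(** The length of the intersection of two intervals. *)
Definition overlap (J K : R * R) : R :=
  Num.max 0 (Num.min J.2 K.2 - Num.max J.1 K.1).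

Definition overlaps n (b d : n.-tuple (R * R)) : R :=
  \prod_(i < n) overlap (tnth b i) (tnth d i).

Lemma overlap_itv (J K : R * R) :
  lebesgue_measure (`[J.1, J.2]%classic `&` `[K.1, K.2]%classic : set E) =
  (overlap J K)%:E.
Proof.
have -> : `[J.1, J.2]%classic `&` `[K.1, K.2]%classic =
    `[Num.max J.1 K.1, Num.min J.2 K.2]%classic.
  apply/seteqP; split => x /=; rewrite !in_itv/= ge_max le_min.
    by move=> [/andP[-> ->] /andP[-> ->]].
  by move=> /andP[/andP[-> ->] /andP[-> ->]].
rewrite lebesgue_measure_itv /= lte_fin /overlap; case: ifPn => h.
  by rewrite -EFinD; congr EFin; apply/esym/max_idPr; lra.
by congr EFin; apply/esym/max_idPl; move: h; rewrite -leNgt; lra.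
Qed.

(** The left-hand side is what polarisation produces from the variances of
    increments. *)
Lemma overlap_norm (J K : R * R) : J.1 < J.2 -> K.1 < K.2 ->
  `|K.2 - J.1| + `|K.1 - J.2| - `|K.1 - J.1| - `|K.2 - J.2| = 2 * overlap J K.
Proof.
case: J K => [a b] [c d]; rewrite /overlap /= => ab cd.
have normE (x y : R) : `|y - x| = Num.max x y - Num.min x y.
  by have [xy|yx] := leP x y; [rewrite ger0_norm|rewrite ltr0_norm]; lra.
rewrite !normE; have [bc|cb] := leP b c.
  have ac : a <= c by lra.
  have ad : a <= d by lra.
  have bd : b <= d by lra.
  by rewrite !(max_r ac, min_l ac, max_r ad, min_l ad, max_r bd, min_l bd) max_l; lra.
have [da|ad] := leP a d; last first.
  have ac : c <= a by lra.
  have bd : d <= b by lra.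
  by rewrite !(max_l ac, min_r ac, max_l bd, min_r bd) max_l; lra.
by have [ac|ca] := leP a c; have [bd|db] := leP b d; rewrite max_r; lra.
Qed.

Lemma off_diagonal_valid n (b : n.-tuple (R * R)) : off_diagonal_box b -> valid_itvs b.
Proof. by move=> [p _] J /tnthP[i ->]; exact: p. Qed.

Lemma off_diagonal_apart n (b : n.-tuple (R * R)) : off_diagonal_box b -> apart_steps b.
Proof.
move=> [p tr]; apply/(sortedP (0, 0)) => k; rewrite size_tuple => kn.
have kn' := ltnW kn; set i := Ordinal kn'; set j := Ordinal kn.
rewrite -[nth _ _ k](tnth_nth _ b i) -[nth _ _ k.+1](tnth_nth _ b j).
rewrite /apart; apply: contraT; rewrite negb_or -!leNgt => /andP[h1 h2].
have /(congr1 val)/= : i = j.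
  apply: tr => //; exists (Num.max (tnth b i).1 (tnth b j).1).
  have := p i; have := p j; split; rewrite /= in_itv /= le_max ge_max !lexx ?orbT/= ?h1 ?h2;
    lra.
lia.
Qed.

End overlap.

Section isometry.
Variables (R : realType) (A : WstarProbSpace R) (S : R -> A).
Hypothesis S_bm : free_brownian_motion S.
Local Notation phi := (expect A).
Local Notation E := (measurableTypeR R).
Local Notation C := R[i].

Lemma incr_sqr a b : 0 <= a -> 0 <= b ->
  phi ((S b - S a) * (S b - S a)) = `|b - a|%:C%C.
Proof.
move=> a0 b0; have [ab|ba|->] := ltgtP a b.
- have [_ -> _] := @incr_moments _ _ _ S_bm (a, b) (introT andP (conj a0 ab)).
  by rewrite gtr0_norm ?subr_gt0.
- have -> : (S b - S a) * (S b - S a) = (S a - S b) * (S a - S b).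
    by rewrite -[S b - S a]opprB mulrNN.
  have [_ -> _] := @incr_moments _ _ _ S_bm (b, a) (introT andP (conj b0 ba)).
  by rewrite ltr0_norm ?subr_lt0// opprB.
- by rewrite !subrr mul0r expect0 normr0.
Qed.

(** Polarisation: the product of two increments is a combination of squares of
    increments, whose expectations are lengths. *)
Lemma expect_incr2 J K : 0 <= J.1 < J.2 -> 0 <= K.1 < K.2 ->
  phi (incr S J * incr S K) = (overlap J K)%:C%C.
Proof.
move=> /andP[J1 J2] /andP[K1 K2].
have J3 : 0 <= J.2 by lra.
have K3 : 0 <= K.2 by lra.
apply: (@mulfI _ 2); first by rewrite pnatr_eq0.
have -> : 2 * phi (incr S J * incr S K) =
    (`|K.2 - J.1| + `|K.1 - J.2| - `|K.1 - J.1| - `|K.2 - J.2|)%:C%C.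
  rewrite !rmorphB rmorphD /= -!incr_sqr// /incr.
  rewrite !mulrBl !mulrBr !expectB.
  rewrite [phi (S K.2 * S J.1)]expect_tracial [phi (S K.1 * S J.1)]expect_tracial.
  rewrite [phi (S K.2 * S J.2)]expect_tracial [phi (S K.1 * S J.2)]expect_tracial.
  ring.
by rewrite overlap_norm// rmorphM rmorph_nat.
Qed.

Variable n : nat.
Implicit Types (b d : n.-tuple (R * R)) (c : seq (C * n.-tuple (R * R))).

Lemma box_integralE b : box_integral S b = bprod S b.
Proof. by rewrite /bprod big_tuple. Qed.

Lemma box_ip b d : off_diagonal_box b -> off_diagonal_box d ->
  ip (box_integral S b) (box_integral S d) = (overlaps b d)%:C%C.
Proof.
move=> ob od; rewrite !box_integralE (bprod_ip S_bm); first last.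
- exact: off_diagonal_apart.
- exact: off_diagonal_apart.
- exact: off_diagonal_valid.
- exact: off_diagonal_valid.
- by rewrite !size_tuple.
rewrite (big_nth ((0, 0), (0, 0))) size_zip !size_tuple minnn big_mkord.
rewrite rmorph_prod; apply: eq_bigr => i _.
rewrite nth_zip ?size_tuple//= -!tnth_nth.
by apply: expect_incr2; [have [h _] := ob|have [h _] := od]; exact: h.
Qed.

Definition box_set b : set (n.-tuple E) :=
  rect n (fun i => `[(nth (0, 0) b i).1, (nth (0, 0) b i).2]%classic).

Lemma measurable_box_set b : measurable (box_set b).
Proof. by apply: measurable_rect => i; exact: measurable_itv. Qed.

Lemma box_indicE b t : box_indic b t = (\1_(box_set b) t)%:C%C.
Proof.
rewrite /box_indic indicE rmorph_nat; congr (_ %:R); congr nat_of_bool.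
apply/forallP/idP => [h|].
  by rewrite inE => i; rewrite /= in_itv /= -!tnth_nth; exact: h.
by rewrite inE => h i; have := h i; rewrite /= in_itv /= -!tnth_nth.
Qed.

Lemma box_set_orthant b : off_diagonal_box b -> box_set b `<=` orthant R n.
Proof.
move=> [p _] t h i; have := h i; rewrite /= in_itv /= -!tnth_nth => /andP[+ _].
by apply: le_trans; have /andP[] := p i.
Qed.

Lemma lebesgueN_boxI b d :
  lebesgueN R n (box_set b `&` box_set d) = (overlaps b d)%:E.
Proof.
have -> : box_set b `&` box_set d = rect n (fun i =>
    `[(nth (0, 0) b i).1, (nth (0, 0) b i).2]%classic `&`
    `[(nth (0, 0) d i).1, (nth (0, 0) d i).2]%classic).
  apply/seteqP; split => t; first by move=> [h h'] i; split.
  by move=> h; split => i; have [] := h i.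
rewrite lebesgueN_rect; last by move=> i; apply: measurableI; exact: measurable_itv.
rewrite /overlaps -prodEFin; apply: eq_bigr => i _.
by rewrite !(tnth_nth (0, 0)) overlap_itv.
Qed.

Lemma cmeasurable_step c : cmeasurable (step_function (R := R) c).
Proof.
split.
  rewrite (_ : (fun t => complex.Re (step_function c t)) =
      (fun t => \sum_(p <- c) complex.Re p.1 * \1_(box_set p.2) t)).
    apply: measurable_sum => p; apply: measurable_funM => //.
    by apply: measurable_indic; exact: measurable_box_set.
  apply/funext => t; rewrite /step_function; elim/big_ind2: _ => //.
    by move=> _ u _ v <- <-; rewrite ReD.
  by move=> p _; rewrite box_indicE; case: p.1 => x y /=; ring.
rewrite (_ : (fun t => complex.Im (step_function c t)) =
    (fun t => \sum_(p <- c) complex.Im p.1 * \1_(box_set p.2) t)).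
  apply: measurable_sum => p; apply: measurable_funM => //.
  by apply: measurable_indic; exact: measurable_box_set.
apply/funext => t; rewrite /step_function; elim/big_ind2: _ => //.
  by move=> _ [? ?] _ [? ?] <- <-.
by move=> p _; rewrite box_indicE; case: p.1 => x y /=; ring.
Qed.

Lemma sqr_modulus_step c t : sqr_modulus (step_function c t) =
  \sum_(p <- c) \sum_(q <- c) complex.Re (p.1 * q.1^*) *
    \1_(box_set p.2 `&` box_set q.2) t.
Proof.
rewrite -[LHS]/(complex.Re (sqr_modulus _)%:C%C) -mulCconj /step_function conj_sum.
rewrite mulr_suml Re_sum; apply: eq_bigr => p _.
rewrite mulr_sumr Re_sum; apply: eq_bigr => q _.
rewrite conjM !box_indicE indicI conj_real_complex mulrACA -rmorphM.
by case: (p.1 * _) => x y /=; ring.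
Qed.

(** By bilinearity it is enough to compare two boxes; both sides are then the
    product of the overlaps of corresponding intervals. *)
Lemma sqr_norm_step c : (forall p, p \in c -> off_diagonal_box p.2) ->
  sqr_norm (step_function c) = (nrm2 (step_integral S c))%:E.
Proof.
move=> od; rewrite /sqr_norm.
have mB p q : measurable (box_set p `&` box_set q) :=
  measurableI _ _ (measurable_box_set p) (measurable_box_set q).
have iB p q : (lebesgueN R n).-integrable (orthant R n)
    (fun t => (\1_(box_set p `&` box_set q) t)%:E).
  apply/integrableP; split.
    by apply/measurable_EFinP; exact: measurable_indic.
  under eq_integral do rewrite gee0_abs ?lee_fin//.
  rewrite integral_indic; [|exact: measurable_orthant|exact: mB].
  apply: (@le_lt_trans _ _ (lebesgueN R n (box_set p `&` box_set q))).
    apply: le_measure; rewrite ?inE; [|exact: mB|exact: subIsetl].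
    by apply: measurableI; [exact: mB|exact: measurable_orthant].
  by rewrite lebesgueN_boxI ltry.
have iZ p q : (lebesgueN R n).-integrable (orthant R n) (fun t =>
    (complex.Re (p.1 * q.1^*))%:E * (\1_(box_set p.2 `&` box_set q.2) t)%:E)%E.
  by apply: integrableZl; [exact: measurable_orthant|exact: iB].
under eq_integral do rewrite sqr_modulus_step -sumEFin.
rewrite integral_sum; [|exact: measurable_orthant|]; last first.
  move=> p; under eq_fun do rewrite -sumEFin; apply: integrable_sum.
    exact: measurable_orthant.
  by move=> q _; under eq_fun do rewrite EFinM; exact: iZ.
rewrite /nrm2 /step_integral ip_suml Re_sum -sumEFin.
apply: eq_big_seq => p /od op.
under eq_integral do rewrite -sumEFin.
rewrite integral_sum; [|exact: measurable_orthant|]; last first.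
  by move=> q; under eq_fun do rewrite EFinM; exact: iZ.
rewrite ip_sumr Re_sum -sumEFin; apply: eq_big_seq => q /od oq.
under eq_integral do rewrite EFinM.
rewrite integralZl; [|exact: measurable_orthant|exact: iB].
rewrite integral_indic; [|exact: measurable_orthant|exact: mB].
rewrite setIidl; last by apply: subset_trans (box_set_orthant op); exact: subIsetl.
rewrite [X in (_ * X)%E](_ : _ = (overlaps p.2 q.2)%:E); last exact: lebesgueN_boxI.
rewrite -EFinM; congr EFin.
rewrite ipZl ipZr box_ip// mulrA.
by case: (p.1 * _) => x y /=; ring.
Qed.

End isometry.

(** * Limits of step integrals *)

(** Cauchy-Schwarz bounds squares, from which convergence is recovered through
    the square root. *)
Lemma cvg0_sqr_le (R : realType) (u d : nat -> R) (M : R) :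
  (forall k, u k ^+ 2 <= M * d k) -> d k @[k --> \oo] --> (0 : R) ->
  u k @[k --> \oo] --> (0 : R).
Proof.
move=> ud d0; apply/norm_cvg0P.
have e k : `|u k| = Num.sqrt (u k ^+ 2) by rewrite sqrtr_sqr.
under eq_fun do rewrite e.
rewrite -(@sqrtr0 R); apply: continuous_cvg; first exact: sqrt_continuous.
apply: (@squeeze_cvgr _ _ _ _ (fun=> 0) (fun k => M * d k)).
- by near=> k; rewrite sqr_ge0 ud.
- exact: cvg_cst.
- by rewrite -(mulr0 M); apply: cvgM => //; exact: cvg_cst.
Unshelve. all: by end_near. Qed.

Section limit_of_integrals.
Variables (R : realType) (A : WstarProbSpace R) (S : R -> A).
Hypothesis S_bm : free_brownian_motion S.
Local Notation phi := (expect A).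
Local Notation C := R[i].
Variable n : nat.
Variables (c : nat -> seq (C * n.-tuple (R * R))) (X : A).
Hypothesis c_off : forall k p, p \in c k -> off_diagonal_box p.2.
Hypothesis c_lim : nrm2 (X - step_integral S (c k)) @[k --> \oo] --> (0 : R).

Local Notation I k := (step_integral S (c k)).

Lemma admissible_box (b : n.-tuple (R * R)) : off_diagonal_box b -> admissible n b.
Proof.
by move=> ob; split; [exact: off_diagonal_valid|exact: off_diagonal_apart|exact: size_tuple].
Qed.

Definition seq_steps (s : seq (C * n.-tuple (R * R))) : seq (C * seq (R * R)) :=
  [seq (p.1, tval p.2) | p <- s].

Lemma step_integral_comb s : step_integral S s = combination S (seq_steps s).
Proof.
by rewrite /combination big_map; apply: eq_bigr => p _; rewrite box_integralE.
Qed.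

Lemma admissible_steps k : admissible_comb n (seq_steps (c k)).
Proof. by move=> _ /mapP[p pk ->] /=; apply: admissible_box; exact: c_off pk. Qed.

(** The map [D] to [phi (T * D)] is continuous for the L^2(phi)-norm by the
    Cauchy-Schwarz inequality, and it vanishes on the step integrals, which
    converge to [X]. *)
Lemma limit_expect0 (T : A) :
  (forall b : n.-tuple (R * R), off_diagonal_box b ->
    phi (T * box_integral S b) = 0) -> phi (T * X) = 0.
Proof.
move=> h; have hI k : phi (T * I k) = 0.
  rewrite /step_integral mulr_sumr linear_sum big_seq big1// => p /c_off op.
  by rewrite -scalerAr expectZ h// mulr0.
have e k : phi (T * X) = ip (X - I k) (vn_star T).
  by rewrite /ip starK mulrBr expectB hI subr0.
have bound k : sqr_modulus (phi (T * X)) <= nrm2 (X - I k) * nrm2 (vn_star T).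
  by rewrite (e k); exact: expect_CauchySchwarz.
apply/eqP; rewrite -sqr_modulus_eq0 eq_le sqr_modulus_ge0 andbT.
rewrite -(mul0r (nrm2 (vn_star T))).
have lim : nrm2 (X - I k) * nrm2 (vn_star T) @[k --> \oo] --> 0 * nrm2 (vn_star T).
  by apply: cvgM => //; exact: cvg_cst.
by apply: (cvgr_to_ge lim); near=> k; exact: bound.
Unshelve. all: by end_near. Qed.

Lemma cvg_Re_ip (z : A) :
  complex.Re (ip z (I k)) @[k --> \oo] --> complex.Re (ip z X).
Proof.
have -> : (fun k => complex.Re (ip z (I k))) =
    (fun k => complex.Re (ip z X) - complex.Re (ip z (X - I k))).
  apply/funext => k.
  by rewrite ipBr; case: (ip z X) (ip z (I k)) => [? ?] [? ?] /=; lra.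
rewrite -[X in _ --> X]subr0.
apply: cvgB; first exact: cvg_cst.
apply: (cvg0_sqr_le (M := nrm2 z)) c_lim => k.
apply: le_trans (expect_CauchySchwarz _ _).
by rewrite /sqr_modulus lerDl sqr_ge0.
Qed.

Lemma cvg_Im_ip (z : A) :
  complex.Im (ip z (I k)) @[k --> \oo] --> complex.Im (ip z X).
Proof.
have -> : (fun k => complex.Im (ip z (I k))) =
    (fun k => complex.Im (ip z X) - complex.Im (ip z (X - I k))).
  apply/funext => k.
  by rewrite ipBr; case: (ip z X) (ip z (I k)) => [? ?] [? ?] /=; lra.
rewrite -[X in _ --> X]subr0.
apply: cvgB; first exact: cvg_cst.
apply: (cvg0_sqr_le (M := nrm2 z)) c_lim => k.
apply: le_trans (expect_CauchySchwarz _ _).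
by rewrite /sqr_modulus lerDr sqr_ge0.
Qed.

Lemma cvg_nrm2 : nrm2 (I k) @[k --> \oo] --> nrm2 X.
Proof.
have -> : (fun k => nrm2 (I k)) =
    (fun k => nrm2 (X - I k) - nrm2 X + 2 * complex.Re (ip X (I k))).
  by apply/funext => k; rewrite nrm2B; lra.
rewrite [X in _ --> X](_ : _ = 0 - nrm2 X + 2 * complex.Re (ip X X)); last first.
  by rewrite /nrm2; lra.
apply: cvgD; last by apply: cvgM; [exact: cvg_cst|exact: cvg_Re_ip].
by apply: cvgB; [exact: c_lim|exact: cvg_cst].
Qed.

(** Otherwise [X] would be orthogonal to all the step integrals, hence to
    their limit [X]. *)
Lemma exists_box : nrm2 X != 0 -> exists b : n.-tuple (R * R),
  off_diagonal_box b /\ ip X (bprod S b) != 0.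
Proof.
move=> X0; apply: contrapT => h; move/eqP: X0; apply.
rewrite /nrm2 /ip limit_expect0// => b ob; apply/eqP/negPn/negP => bX.
apply: h; exists b; split => //.
by rewrite ipC /ip -box_integralE fmorph_eq0.
Qed.

(** The two factors are replaced by step integrals one after the other: with
    the other factor fixed, each replacement is linear and [limit_expect0]
    applies, whereas the product is not jointly continuous for the
    L^2(phi)-norm. *)
Lemma square_wick_comb_ip m (c1 c2 : seq (C * seq (R * R))) : n = m.+1 ->
  admissible_comb n c1 -> admissible_comb n c2 ->
  ip (X * X) (wick_comb S c1 c2) = ip X (combination S c1) * ip X (combination S c2).
Proof.
move=> nm g1 g2; set W := wick_comb S c1 c2.
(* The right factor first; traciality then moves the left factor to the end.
   *)
have stepA (d : n.-tuple (R * R)) : off_diagonal_box d ->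
    ip (box_integral S d * X) W =
    ip (box_integral S d) (combination S c1) * ip X (combination S c2).
  move=> od; apply/eqP; rewrite -subr_eq0; apply/eqP.
  have := @limit_expect0 (vn_star W * box_integral S d -
    ip (box_integral S d) (combination S c1) *: vn_star (combination S c2)).
  rewrite mulrBl expectB -scalerAl expectZ -mulrA; apply => d' od'.
  rewrite mulrBl expectB -scalerAl expectZ -mulrA -!/(ip _ _) !box_integralE.
  have gd := admissible_box od; have gd' := admissible_box od'; subst n.
  by rewrite (wick_comb_ip S_bm g1 g2 gd gd') subrr.
apply/eqP; rewrite -subr_eq0; apply/eqP.
have := @limit_expect0 (X * vn_star W - ip X (combination S c2) *: vn_star (combination S c1)).
rewrite mulrBl expectB -scalerAl expectZ -[X in phi X - _]mulrA expect_tracial -mulrA.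
rewrite -!/(ip _ _) [ip X (combination S c2) * _]mulrC; apply => d od.
rewrite mulrBl expectB -scalerAl expectZ -[X in phi X - _]mulrA expect_tracial -mulrA.
by rewrite -!/(ip _ _) stepA// mulrC subrr.
Qed.

Lemma incr_wick_comb_ip m (J : R * R) (c2 : seq (C * seq (R * R))) : n = m.+1 ->
  admissible 1 [:: J] -> admissible_comb n c2 ->
  ip (incr S J * X) (wick_comb S [:: (1, [:: J])] c2) =
  ip (incr S J) (incr S J) * ip X (combination S c2).
Proof.
move=> nm gJ g2; set W := wick_comb S _ c2.
apply/eqP; rewrite -subr_eq0; apply/eqP.
have := @limit_expect0 (vn_star W * incr S J -
    ip (incr S J) (incr S J) *: vn_star (combination S c2)).
rewrite mulrBl expectB -scalerAl expectZ -mulrA; apply => d od.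
rewrite mulrBl expectB -scalerAl expectZ -mulrA -!/(ip _ _) !box_integralE.
have gd := admissible_box od; subst n.
have g1 : admissible_comb 1 [:: (1 : C, [:: J])] by move=> p; rewrite inE => /eqP->.
have := wick_comb_ip S_bm g1 g2 gJ gd.
rewrite -/W /combination big_seq1 /= scale1r /bprod big_seq1 -/(bprod S d) => ->.
by rewrite subrr.
Qed.

End limit_of_integrals.

(** * Adjoint and non-vanishing of a Wigner integral *)

Section wigner.
Variables (R : realType) (A : WstarProbSpace R) (S : R -> A).
Hypothesis S_bm : free_brownian_motion S.
Local Notation phi := (expect A).
Local Notation C := R[i].
Variable n : nat.

Section reversal.
Implicit Types (b : n.-tuple (R * R)) (s : seq (C * n.-tuple (R * R))).

Definition box_rev b : n.-tuple (R * R) := [tuple of rev b].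

Lemma tnth_box_rev b i : tnth (box_rev b) i = tnth b (rev_ord i).
Proof. by rewrite !(tnth_nth (0, 0)) /= nth_rev ?size_tuple. Qed.

Lemma off_diagonal_rev b : off_diagonal_box b -> off_diagonal_box (box_rev b).
Proof.
move=> [p tr]; split; first by move=> i; rewrite tnth_box_rev; exact: p.
move=> i j _ _; rewrite !tnth_box_rev => h.
by apply: (can_inj (@rev_ordK n)); exact: tr h.
Qed.

Lemma box_integral_star b : off_diagonal_box b ->
  vn_star (box_integral S b) = box_integral S (box_rev b).
Proof.
move=> ob; rewrite !box_integralE /bprod star_prod.
apply: eq_big_seq => J; rewrite mem_rev => Jb; apply: (incr_star S_bm).
exact: (off_diagonal_valid ob).
Qed.

Lemma box_indic_rev b t : box_indic (box_rev b) t = box_indic b (tuple_rev t).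
Proof.
rewrite /box_indic; congr (_%:R); congr nat_of_bool.
apply/forallP/forallP => h i.
  by have := h (rev_ord i); rewrite tnth_box_rev rev_ordK tnth_tuple_rev.
by have := h (rev_ord i); rewrite tnth_tuple_rev rev_ordK tnth_box_rev.
Qed.

Definition steps_star s := [seq (p.1^*, box_rev p.2) | p <- s].

Lemma step_integral_star s : (forall p, p \in s -> off_diagonal_box p.2) ->
  step_integral S (steps_star s) = vn_star (step_integral S s).
Proof.
move=> od; rewrite /step_integral star_sum big_map.
by apply: eq_big_seq => p /od op; rewrite starZ box_integral_star.
Qed.

Lemma step_function_star s t :
  step_function (steps_star s) t = mirror (step_function s) t.
Proof.
rewrite /mirror /step_function conj_sum big_map; apply: eq_bigr => p _ /=.
by rewrite conjM box_indic_rev box_indicE conj_real_complex.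
Qed.

Definition steps_opp s := [seq (- p.1, p.2) | p <- s].

Lemma step_integral_opp s : step_integral S (steps_opp s) = - step_integral S s.
Proof.
rewrite /step_integral big_map -sumrN; apply: eq_bigr => p _.
by rewrite scaleNr.
Qed.

Lemma step_function_opp s t : step_function (steps_opp s) t = - step_function s t.
Proof.
rewrite /step_function big_map -sumrN; apply: eq_bigr => p _.
by rewrite mulNr.
Qed.

(** The difference of a step integral and its adjoint is again a step
    integral, so the isometry computes its norm. *)
Lemma nrm2_step_sub_star s : (forall p, p \in s -> off_diagonal_box p.2) ->
  (nrm2 (step_integral S s - vn_star (step_integral S s)))%:E =
  sqr_norm (fun t => step_function s t - mirror (step_function s) t).
Proof.
move=> od; rewrite -step_integral_star// -step_integral_opp.
rewrite /step_integral -big_cat -/(step_integral S (s ++ steps_opp (steps_star s))).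
rewrite -sqr_norm_step//; last first.
  move=> p; rewrite mem_cat => /orP[/od//|/mapP[_ /mapP[q /od oq ->] ->]].
  exact: off_diagonal_rev.
apply: eq_integral => t _; congr (sqr_modulus _)%:E.
by rewrite /step_function big_cat -!/(step_function _ _) step_function_opp step_function_star.
Qed.

End reversal.

Variables (f : n.-tuple (measurableTypeR R) -> C).
Hypothesis f_sqr : square_integrable f.
Variables (c : nat -> seq (C * n.-tuple (R * R))) (X : A).
Hypothesis c_off : forall k p, p \in c k -> off_diagonal_box p.2.
Hypothesis c_f : sqr_norm (fun t => f t - step_function (c k) t) @[k --> \oo] --> 0%E.
Hypothesis c_lim : nrm2 (X - step_integral S (c k)) @[k --> \oo] --> (0 : R).

Local Notation I k := (step_integral S (c k)).

Let mf : cmeasurable f.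
Proof. by case: f_sqr. Qed.

Let mstep k : cmeasurable (step_function (c k)).
Proof. exact: cmeasurable_step. Qed.

Let dE : (nrm2 (X - I k))%:E @[k --> \oo] --> 0%:E.
Proof. by apply: cvg_EFin; [exact: nearW|exact: c_lim]. Qed.

(** If [X] were zero, the step integrals would tend to zero, hence so would
    the step functions by isometry, and [f] would be zero almost everywhere.
    *)
Lemma wigner_neq0 : ~ ae_orthant (fun t => f t = 0) -> nrm2 X != 0.
Proof.
apply: contra_notN => /eqP /nrm2_eq0 X0.
have bound k : (sqr_norm f <= 2%:E * sqr_norm (fun t => f t - step_function (c k) t)%R +
    2%:E * (nrm2 (X - I k))%:E)%E.
  have -> : nrm2 (X - I k) = nrm2 (I k) by rewrite X0 sub0r nrm2N.
  rewrite -sqr_norm_step//; last exact: c_off.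
  have -> : sqr_norm (step_function (c k)) = sqr_norm (fun t => 0 - step_function (c k) t).
    apply: eq_integral => t _; congr EFin.
    by case: (step_function _ _) => x y; rewrite /sqr_modulus /= !sub0r !sqrrN.
  apply: sqr_normB_le => //.
  - exact: cmeasurableB.
  - by apply: cmeasurableB => //; split; exact: measurable_cst.
  - by move=> t _; rewrite sub0r opprK subrK.
have f0 : sqr_norm f = 0%E.
  apply/eqP; rewrite eq_le sqr_norm_ge0 andbT.
  have lim : (2%:E * sqr_norm (fun t => f t - step_function (c k) t)%R +
      2%:E * (nrm2 (X - I k))%:E)%E @[k --> \oo] --> (2%:E * 0 + 2%:E * 0%:E)%E.
    apply: cvgeD; first by rewrite !mule0 fin_num_adde_defl.
      by apply: cvgeZl => //; exact: c_f.
    apply: cvgeZl => //; exact: dE.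
  rewrite !mule0 adde0 in lim.
  by apply: (cvge_to_ge lim); near=> k; exact: bound.
have := (ae_eq_integral_abs (lebesgueN R n) (@measurable_orthant R n)
  (cmeasurable_sqr mf)).1.
under eq_integral do rewrite gee0_abs ?lee_fin ?sqr_modulus_ge0//.
move=> /(_ f0); rewrite /ae_orthant; apply: filterS => t h Ot.
have h0 : (sqr_modulus (f t))%:E = 0%:E := h Ot.
by apply/eqP; rewrite -sqr_modulus_eq0 (EFin_inj h0).
Unshelve. all: by end_near. Qed.

(** By isometry, the step integrals are asymptotically self-adjoint because
    the step functions are asymptotically mirror symmetric: both they and
    their mirror images converge to [f]. *)
Lemma wigner_star : mirror_symmetric f -> vn_star X = X.
Proof.
move=> f_mir; pose a k := sqr_norm (fun t => f t - step_function (c k) t).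
have sym k : sqr_norm (fun t => f t - mirror (step_function (c k)) t) = a k.
  rewrite /a -[RHS]sqr_norm_mirror; last exact: cmeasurableB.
  apply: ge0_ae_eq_integral.
  - exact: measurable_orthant.
  - by apply: cmeasurable_sqr; apply: cmeasurableB => //; exact: cmeasurable_mirror.
  - by apply: cmeasurable_sqr; apply: cmeasurable_mirror; exact: cmeasurableB.
  - by move=> t _; rewrite lee_fin sqr_modulus_ge0.
  - by move=> t _; rewrite lee_fin sqr_modulus_ge0.
  - move: f_mir; rewrite /mirror_symmetric /ae_orthant.
    apply: filterS => t h Ot; congr (sqr_modulus _)%:E.
    by rewrite /mirror (h Ot); rewrite -rmorphB.
have bound k : ((nrm2 (X - vn_star X))%:E <=
    6%:E * (nrm2 (X - I k))%:E + 4%:E * (2%:E * a k + 2%:E * a k))%E.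
  have h : ((nrm2 (I k - vn_star (I k)))%:E <= 2%:E * a k + 2%:E * a k)%E.
    rewrite nrm2_step_sub_star; last exact: c_off.
    rewrite -[X in (_ <= 2%:E * X + _)%E]sym.
    apply: sqr_normB_le.
    - by apply: cmeasurableB => //; exact: cmeasurable_mirror.
    - by apply: cmeasurableB => //; exact: cmeasurable_mirror.
    - exact: cmeasurableB.
    - by move=> t _; ring.
  apply: le_trans (leeD2l _ (lee_wpmul2l _ h)); last by rewrite lee_fin.
  rewrite -!EFinM -EFinD lee_fin.
  have -> : X - vn_star X =
      ((X - I k) + (I k - vn_star (I k))) + (- vn_star (X - I k)).
    by rewrite starB opprB [X - _ + _]addrA subrK addrA subrK.
  have := nrm2D_le ((X - I k) + (I k - vn_star (I k))) (- vn_star (X - I k)).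
  have := nrm2D_le (X - I k) (I k - vn_star (I k)).
  by rewrite nrm2N nrm2_star; lra.
have lim : (6%:E * (nrm2 (X - I k))%:E + 4%:E * (2%:E * a k + 2%:E * a k))%E
    @[k --> \oo] --> (6%:E * 0%:E + 4%:E * (2%:E * 0 + 2%:E * 0))%E.
  have a2 : (2%:E * a k + 2%:E * a k)%E @[k --> \oo] --> (2%:E * 0 + 2%:E * 0)%E.
    apply: cvgeD; first by rewrite !mule0 fin_num_adde_defl.
      by apply: cvgeZl => //; exact: c_f.
    by apply: cvgeZl => //; exact: c_f.
  apply: cvgeD; first by rewrite !mule0 adde0 mule0 fin_num_adde_defl.
    by apply: cvgeZl => //; exact: dE.
  by apply: cvgeZl => //; exact: a2.
rewrite !mule0 !adde0 mule0 adde0 in lim.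
have : (nrm2 (X - vn_star X))%:E = 0%E.
  apply/eqP; rewrite eq_le [X in _ && X]lee_fin nrm2_ge0 andbT.
  by apply: (cvge_to_ge lim); near=> k; exact: bound.
by move=> [] /nrm2_eq0 /eqP; rewrite subr_eq0 => /eqP <-.
Unshelve. all: by end_near. Qed.

End wigner.

(** * The fourth moment *)

Section fourth_moment.
Variables (R : realType) (A : WstarProbSpace R) (S : R -> A).
Hypothesis S_bm : free_brownian_motion S.
Local Notation phi := (expect A).
Local Notation C := R[i].
Variable m : nat.
Local Notation n := m.+2.
Variables (c : nat -> seq (C * n.-tuple (R * R))) (X : A).
Hypothesis c_off : forall k p, p \in c k -> off_diagonal_box p.2.
Hypothesis c_lim : nrm2 (X - step_integral S (c k)) @[k --> \oo] --> (0 : R).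
Hypothesis X_star : vn_star X = X.
Hypothesis X_neq0 : nrm2 X != 0.

Local Notation I k := (step_integral S (c k)).

Lemma admissible_head (J : R * R) b p : admissible p.+1 (J :: b) -> admissible 1 [:: J].
Proof. by move=> [v _ _]; split=> // K; rewrite inE => /eqP->; apply: v; rewrite mem_head. Qed.

(** The scalar product is the squared norm of [incr S J * X] minus [nrm2 (incr
    S J) * nrm2 X]. The Wick products of [J] with the approximating step
    integrals account for [nrm2 (incr S J) * nrm2 X]; they are orthogonal to
    the tail [b] of the box [J :: b], whose scalar product with [incr S J * X]
    is that of the whole box with [X]. *)
Lemma exists_chaos2_component : exists J, admissible 1 [:: J] /\
  ip (X * X) (wick_bprod S [:: J] [:: J]) != 0.
Proof.
have [w [ow wX]] := exists_box c_off c_lim X_neq0.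
have gw := admissible_box ow; case: (tval w) gw wX => [[]//|J b] gw wX.
have gJ := admissible_head gw; have gb := admissible_behead gw.
exists J; split => //.
have Jstar : vn_star (incr S J) = incr S J.
  by apply: (incr_star S_bm); case: gJ => h _ _; apply: h; rewrite mem_head.
have -> : ip (X * X) (wick_bprod S [:: J] [:: J]) =
    (nrm2 (incr S J * X) - nrm2 (incr S J) * nrm2 X)%:C%C.
  rewrite rmorphB rmorphM /= -!ip_nrm2.
  rewrite /wick_bprod /= /wick /= /rev /= !big_nil mulr1 mul1r /ip.
  rewrite starB starM starZ star1 !starM Jstar X_star.
  rewrite mulrBl -scalerAl mul1r expectB expectZ -expect_star starM Jstar.
  congr (_ - _); rewrite expect_tracial -[X * X * _]mulrA expect_tracial.
  by rewrite !mulrA.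
suff : nrm2 (incr S J) * nrm2 X < nrm2 (incr S J * X).
  by move=> h; rewrite fmorph_eq0 subr_eq0 gt_eqF.
have gJ1 : admissible_comb 1 [:: (1 : C, [:: J])] by move=> p; rewrite inE => /eqP->.
have gs k : admissible_comb n (seq_steps (c k)) by exact: admissible_steps.
apply: (bessel_strict (Y := fun k => wick_comb S [:: (1, [:: J])] (seq_steps (c k)))
  (e := bprod S b)).
- move=> k.
  have g0 : admissible 0 (nil : seq (R * R)) by [].
  have := wick_comb_low S_bm gJ1 (gs k) g0 gb isT isT.
  rewrite {1}/bprod big_nil mul1r; apply; lia.
- have e k : complex.Re (ip (incr S J * X) (wick_comb S [:: (1, [:: J])] (seq_steps (c k)))) =
      nrm2 (incr S J) * complex.Re (ip X (I k)).
    rewrite (incr_wick_comb_ip S_bm c_off c_lim (m := m.+1))// ip_nrm2 step_integral_comb.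
    by case: (ip X _) => x y /=; ring.
  rewrite (funext e); apply: cvgM; first exact: cvg_cst.
  exact: cvg_Re_ip.
- have e k : nrm2 (wick_comb S [:: (1, [:: J])] (seq_steps (c k))) =
      nrm2 (incr S J) * nrm2 (I k).
    rewrite (nrm2_wick_comb S_bm gJ1 (gs k)) step_integral_comb; congr (nrm2 _ * _).
    by rewrite /combination big_seq1 scale1r /bprod big_seq1.
  rewrite (funext e); apply: cvgM; first exact: cvg_cst.
  exact: cvg_nrm2.
- apply: contra_neq wX => h.
  by rewrite -h /ip /bprod big_cons starM Jstar mulrA.
Qed.

(** Bessel's inequality for [X * X] minus its expectation, against the Wick
    squares of the approximating step integrals and one centred square of an
    increment. *)
Lemma fourth_moment_gt : 2 * nrm2 X ^+ 2 < nrm2 (X * X).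
Proof.
have [J [gJ qJ]] := exists_chaos2_component; set U := wick_bprod S _ _ in qJ.
pose N := nrm2 X; pose Y k := wick_comb S (seq_steps (c k)) (seq_steps (c k)).
have gs k : admissible_comb n (seq_steps (c k)) by exact: admissible_steps.
have g0 : admissible 0 (nil : seq (R * R)) by [].
have one_Y k : ip 1 (Y k) = 0.
  have := wick_comb_low S_bm (gs k) (gs k) g0 g0 isT isT.
  by rewrite /bprod !big_nil mulr1; apply; lia.
have UE : U = incr S J * incr S J - phi (incr S J * incr S J) *: 1.
  by rewrite /U /wick_bprod /= /wick /= /rev /= !big_nil mulr1 mul1r.
have U_Y k : ip U (Y k) = 0.
  rewrite UE ipBl ipZl one_Y mulr0 subr0.
  have := wick_comb_low S_bm (gs k) (gs k) gJ gJ isT isT.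
  by rewrite /bprod !big_seq1; apply; lia.
have U1 : ip 1 U = 0.
  by rewrite ipC /ip star1 mul1r UE expectB expectZ expect1 mulr1 subrr conjC0.
have XX1 : ip (X * X) 1 = N%:C%C by rewrite /N -ip_nrm2 /ip star1 mul1r X_star.
have N2 : nrm2 (X * X - N%:C%C *: 1) = nrm2 (X * X) - N ^+ 2.
  rewrite nrm2B nrm2Z ipZr XX1 conj_real_complex /sqr_modulus /=.
  have -> : nrm2 (1 : A) = 1 by rewrite /nrm2 /ip star1 mul1r expect1.
  by ring.
suff : N ^+ 2 < nrm2 (X * X - N%:C%C *: 1) by rewrite N2; rewrite /N; lra.
have IE k : I k = combination S (seq_steps (c k)) by exact: step_integral_comb.
apply: (bessel_strict (Y := Y) (e := U)) => //.
- have e k : complex.Re (ip (X * X - N%:C%C *: 1) (Y k)) =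
      complex.Re (ip X (I k)) ^+ 2 - complex.Im (ip X (I k)) ^+ 2.
    rewrite ipBl ipZl one_Y mulr0 subr0 (square_wick_comb_ip S_bm c_off c_lim (m := m.+1))// IE.
    by case: (ip X _) => x y /=; ring.
  rewrite (funext e).
  have -> : N ^+ 2 = complex.Re (ip X X) * complex.Re (ip X X) -
      complex.Im (ip X X) * complex.Im (ip X X).
    by rewrite ip_nrm2 /= mulr0 subr0.
  by apply: cvgB; apply: cvgM; solve [exact: cvg_Re_ip|exact: cvg_Im_ip].
- have e k : nrm2 (Y k) = nrm2 (I k) * nrm2 (I k).
    by rewrite (nrm2_wick_comb S_bm (gs k) (gs k)) IE.
  by rewrite (funext e); apply: cvgM; exact: cvg_nrm2.
- by rewrite ipBl ipZl U1 mulr0 subr0.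
Qed.

End fourth_moment.

Theorem corollary1p7 (R : realType) (A : WstarProbSpace R) (S : R -> A)
    (hS : free_brownian_motion S)
    (n : nat) (hn : (2 <= n)%N)
    (f : n.-tuple (measurableTypeR R) -> R[i])
    (hf : square_integrable f)
    (hf_mirror : mirror_symmetric f)
    (hf_nonzero : ~ ae_orthant (fun t => f t = 0))
    (X : A) (hX : is_wigner_integral S f X) :
  2 * expect A (X ^+ 2) ^+ 2 < expect A (X ^+ 4) /\ ~ is_semicircular X.
Proof.
have [c [c_off c_f c_lim]] := hX.
have X_star : vn_star X = X.
  exact: (wigner_star hS hf c_off c_f c_lim hf_mirror).
have X_neq0 : nrm2 X != 0.
  exact: (wigner_neq0 hS hf c_off c_f c_lim hf_nonzero).
have X2 : expect A (X ^+ 2) = (nrm2 X)%:C%C.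
  by rewrite -ip_nrm2 /ip X_star expr2.
have X4 : expect A (X ^+ 4) = (nrm2 (X * X))%:C%C.
  by rewrite -ip_nrm2 /ip starM X_star -!expr2 -exprM.
have lt4 : 2 * nrm2 X ^+ 2 < nrm2 (X * X).
  case: n hn c c_off c_lim {f hf hf_mirror hf_nonzero hX c_f} => [//|[//|m]] _ c c_off c_lim.
  exact: (fourth_moment_gt hS c_off c_lim X_star X_neq0).
have lt : 2 * expect A (X ^+ 2) ^+ 2 < expect A (X ^+ 4).
  by rewrite X2 X4 -(rmorph_nat (real_complex R)) -rmorphXn -rmorphM ltcR.
split=> //; case=> t t0 /(semicircular_moments t0)[_ m2 m4].
by move: lt; rewrite (_ : X ^+ 4 = X * X * (X * X)) ?m4 ?expr2 ?m2 ?ltxx// -!expr2 -exprM.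
Qed.
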